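(* Let $D$ be a Newton diagram in $3$ variables whose support $K\subset\mathbb N_0^3$ has size $d$ and satisfies the no-overhang condition. Then $\#(D)\ge 2d+2$.
   Context: For $m\in\mathbb Z^n$ write $|m|=m_1+\dots+m_n$; $e_1,\dots,e_n$ is the standard basis. A Newton diagram in $n$ variables is a function $D\colon\mathbb Z^n\to\{0,P,N\}$ ($P,N$ formal symbols) whose support $K=D^{-1}(\{P,N\})$ is a finite nonempty subset of $\mathbb N_0^n$. For $a\in\mathbb Z^n$ let $E(a)=\{a,a-e_1,\dots,a-e_n\}$; $E(a)$ is a node of $D$ if the image $D(E(a))$ equals $\{P\}$, $\{N\}$, $\{0,P\}$ or $\{0,N\}$. $\#(D)$ is the number of $a\in\mathbb Z^n$ for which $E(a)$ is a node. The size of $K$ is $k-|a|+1$ where $k=\max_{m\in K}|m|$ and $a_j=\min_{m\in K}m_j$. Overhangs: for $K\subset\mathbb Z^2$, a point $(a,b)\in K$ with $(a,b)\ne(0,0)$ is a left overhang if $(a,b-1)\notin K$ and $(a-1,y)\notin K$ for all $y\ge b$; it is a right overhang if $(a-1,b)\notin K$ and $(x,b-1)\notin K$ for all $x\ge a$; an overhang is a left or right overhang. For $K\subset\mathbb Z^3$ define $\pi_1(m)=(m_1,m_2+m_3)$, $\pi_2(m)=(m_1+m_3,m_2)$, $\pi_3(m)=(m_1+m_2,m_3)$; $m\in K$ is an overhang if $\pi_j(m)$ is an overhang of $\pi_j(K)$ for some $j$. $K$ satisfies the no-overhang condition if it has no overhang. *)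

(* Defs.v *)
From HB Require Import structures.
From mathcomp Require Import all_boot all_order all_algebra.
Set Implicit Arguments. Unset Strict Implicit. Unset Printing Implicit Defensive.
Import Order.TTheory GRing.Theory Num.Theory.
Local Open Scope ring_scope.

Inductive sgn := S0 | SP | SN.

Definition sgn_eqb (x y : sgn) : bool :=
  match x, y with S0, S0 | SP, SP | SN, SN => true | _, _ => false end.
Lemma sgn_eqP : Equality.axiom sgn_eqb.
Proof. by case; case; constructor. Qed.
HB.instance Definition _ := hasDecEq.Build sgn sgn_eqP.

Definition Z3 := (int * int * int)%type.
Definition Z2 := (int * int)%type.
Definition c1 (m : Z3) : int := m.1.1.
Definition c2 (m : Z3) : int := m.1.2.
Definition c3 (m : Z3) : int := m.2.
Definition pt (x y z : int) : Z3 := (x, y, z).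

Definition abs1 (m : Z3) : int := c1 m + c2 m + c3 m.

(* A Newton diagram in 3 variables: D : Z^3 -> {0,P,N}; its support is
   K = D^{-1}{P,N}. *)
Definition support_is (D : Z3 -> sgn) (K : seq Z3) : Prop :=
  forall m, (D m != S0) = (m \in K).

Definition E (a : Z3) : seq Z3 :=
  [:: a; pt (c1 a - 1) (c2 a) (c3 a); pt (c1 a) (c2 a - 1) (c3 a);
      pt (c1 a) (c2 a) (c3 a - 1)].

Definition sameset (s t : seq sgn) : bool := all (mem t) s && all (mem s) t.

Definition is_node (D : Z3 -> sgn) (a : Z3) : bool :=
  let img := [seq D m | m <- E a] in
  [|| sameset img [:: SP], sameset img [:: SN],
      sameset img [:: S0; SP] | sameset img [:: S0; SN]].

Definition maxl (s : seq int) : int := foldr Num.max (head 0 s) s.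
Definition minl (s : seq int) : int := foldr Num.min (head 0 s) s.
Definition size_K (K : seq Z3) : int :=
  maxl (map abs1 K) - (minl (map c1 K) + minl (map c2 K) + minl (map c3 K)) + 1.

Definition left_overhang (K : seq Z2) (p : Z2) : Prop :=
  let: (a, b) := p in
  [/\ p \in K, p != (0, 0), (a, b - 1) \notin K &
      forall y : int, b <= y -> (a - 1, y) \notin K].
Definition right_overhang (K : seq Z2) (p : Z2) : Prop :=
  let: (a, b) := p in
  [/\ p \in K, p != (0, 0), (a - 1, b) \notin K &
      forall x : int, a <= x -> (x, b - 1) \notin K].
Definition overhang2 (K : seq Z2) (p : Z2) : Prop :=
  left_overhang K p \/ right_overhang K p.

Definition pi1 (m : Z3) : Z2 := (c1 m, c2 m + c3 m).
Definition pi2 (m : Z3) : Z2 := (c1 m + c3 m, c2 m).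
Definition pi3 (m : Z3) : Z2 := (c1 m + c2 m, c3 m).

Definition overhang3 (K : seq Z3) (m : Z3) : Prop :=
  m \in K /\
  [\/ overhang2 (map pi1 K) (pi1 m), overhang2 (map pi2 K) (pi2 m)
    | overhang2 (map pi3 K) (pi3 m)].

Definition no_overhang (K : seq Z3) : Prop := forall m, ~ overhang3 K m.

(* Main.v *)
(* Only the no-left-overhang condition for pi_1 is used.  Group the points of the
   support by (u, v) = (m_1, m_2 + m_3); the condition says that at every level
   w = u + v the leftmost nonempty column lam(w) contains a point of that level,
   while no column to its left reaches level w.

   A set E(a) has four points, one for each facet of a simplex, and it is viewed
   from the four facets: a view sees E(a) when the point of E(a) belonging to that
   facet is missing and nothing of the support hides the others.  In each view the
   points and sets arrange into strips between two consecutive rows A and C, and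
   a discrete Gauss-Bonnet inequality
     (weights of the nodes seen) >= 2 + gauge(A) - gauge(C)
   holds, where gauge counts sign changes and breaks along a row.  It telescopes
   over the strips: the two views along e_2 - e_3 go level by level, the left view
   follows the columns lam(w), and the right view goes along rows v, cut into
   clusters at the columns lam(w).  Each view yields about 2 per level.

   A node has total weight 4, which covers all the views that see it unless E(a)
   meets the support in one point seen from three sides.  Those cases are paid for
   by slack in the strip inequalities, by smaller weights where a strip has room,
   and by the gauge gained when a cluster is split in two.  All weights are twice
   the natural half-integral ones. *)

Require Import Defs.
From HB Require Import structures.
From mathcomp Require Import all_boot all_order all_algebra.
From mathcomp Require Import zify.
Import Order.TTheory GRing.Theory Num.Theory.
Set Implicit Arguments. Unset Strict Implicit. Unset Printing Implicit Defensive.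
Local Open Scope nat_scope.

(** * The strip inequality *)

(** A single point seen from three sides overruns the 4 of its node by 2. If it is a - e_1, both
    views along e_2 - e_3 and the right view see it; its right weight is lowered to the gauge of the
    row behind it, and one walk for each of the two other views finds events that pay for this
    gauge. If it is a - e_2 or a - e_3, it lies in the leading column, and an overrun survives only
    where that column ends: at a jump of [lam] or at the last level. The left view pays for a jump,
    since it restarts on a nonempty column and gains 2, one unit for each view along e_2 - e_3. A
    tie at the jump costs one unit more, which the right view recovers by cutting a cluster at the
    new column. The last level costs 2 in each of the two views. With k the largest |m|, the four
    views then leave 8k + 10, so by integrality there are at least 2k + 3 nodes. The origin is a
    node outside all strips, and it makes the count 2k + 4 = 2d + 2. *)

Definition isnode (a b c d : sgn) : bool :=
  (SP \in [:: a; b; c; d]) (+) (SN \in [:: a; b; c; d]).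

Definition support_size (a b c d : sgn) : nat :=
  (a != S0) + (b != S0) + (c != S0) + (d != S0).

(** A node with s points in the support has 4 - s missing points, hence at most 4 - s views. The
    weights 4 for s = 3 and 2 for s = 2 add up to 4; for s = 1 three views of weight 2 add up to
    6. *)
Definition face_weight (a b c d : sgn) : nat :=
  if isnode a b c d then nth 0 [:: 0; 2; 2; 4; 0] (support_size a b c d) else 0.

(* The topmost point over a position, as a rank (0 when there is none, larger is
   closer to the viewer) and a sign (true for SP). *)
Notation vertex := (nat * bool)%type.

(* zig lives on the edges between the rows A and C of a strip, gauge on the edges
   within a row.  Both are tuned so that the triangles (A i, C i+1, A i+1) and
   (C i, A i, C i+1) satisfy cell_ge0 and up_ge0; when a strip is summed the zig
   terms cancel. *)
Definition zig (x y : vertex) : nat :=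
  if (x.1 == y.1) && (0 < x.1) then (if x.2 == y.2 then 0 else 2) else 1.

Definition gauge (x y : vertex) : nat :=
  if x.1 == y.1 then (if (0 < x.1) && (x.2 == y.2) then 2 else 0) else 1.

Definition top_sign (m : nat) (x : vertex) : sgn :=
  if (x.1 == m) && (0 < m) then (if x.2 then SP else SN) else S0.

(** The cell seen has the largest of the three ranks; vertices further back are not in it and count
    as [S0]. The last argument is the missing point of the viewing facet. *)
Definition strip_weight (x y z : vertex) : nat :=
  let m := maxn x.1 (maxn y.1 z.1) in face_weight (top_sign m y) (top_sign m x) (top_sign m z) S0.

Ltac deceq := repeat match goal with
  | |- context [@eq_op _ ?a ?b] =>
    first [have -> : (a == b :> nat) = true by lia | have -> : (a == b :> nat) = false by lia] end;
  repeat match goal with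
  | |- context [0 < ?b] =>
    first [have -> : (0 < b) = true by lia | have -> : (0 < b) = false by lia] end;
  rewrite /=.

(** Only the order of the ranks, their vanishing and the signs matter, so this is a finite check. *)
Lemma cell_ge0 x y z : 2 + gauge x z <= strip_weight x y z + zig x y + zig y z.
Proof.
case: x y z => [a s] [b t] [c r]; rewrite /strip_weight /top_sign /zig /gauge /=.
case: (posnP a) => [->|a0]; case: (posnP b) => [->|b0]; case: (posnP c) => [->|c0];
case: (ltngtP a b) => [ab|ab|ab]; try lia; case: (ltngtP b c) => [bc|bc|bc]; try lia;
 case: (ltngtP a c) => [ac|ac|ac]; try lia;
 deceq;  case: s; case: t; case: r => //=; lia.
Qed.

(** This and the other lemmas in [_ge1] locate the spare units of a strip; here the row C has no
    point ([ph]) and the row A breaks. *)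
Lemma cell_ph_ge1 x y z : y.1 = 0 -> x.1 != z.1 -> 2 + gauge x z + 1 <= strip_weight x y z + zig x y + zig y z.
Proof.
case: x y z => [a s] [b t] [c r] /= -> ac; rewrite /strip_weight /top_sign /zig /gauge /=.
case: (posnP a) => a0; case: (posnP c) => c0; case: (ltngtP a c) ac => // ac _; subst; try lia;
  deceq; case: s; case: r => //=; lia.
Qed.

Lemma cell_top_ge1 x y z : 0 < y.1 -> z.1 = 0 -> x.1 != y.1 ->
  2 + gauge x z + 1 <= strip_weight x y z + zig x y + zig y z.
Proof.
case: x y z => [a s] [b t] [c r] /= b0 -> ab; rewrite /strip_weight /top_sign /zig /gauge /=.
case: (posnP a) => a0; case: (ltngtP a b) ab => // ab _; subst; try lia;
  deceq; case: s; case: t => //=; lia.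
Qed.

Lemma up_ge0 x y z : zig x y + zig y z <= 2 + gauge x z.
Proof.
case: x y z => [a s] [b t] [c r]; rewrite /zig /gauge /=.
case: (posnP a) => [->|a0]; case: (posnP b) => [->|b0]; case: (posnP c) => [->|c0];
case: (ltngtP a b) => [ab|ab|ab]; try lia; case: (ltngtP b c) => [bc|bc|bc]; try lia;
 case: (ltngtP a c) => [ac|ac|ac]; try lia; subst; deceq;
 case: s; case: t; case: r => //=; lia.
Qed.

Lemma upr_ge1 x y z : 0 < x.1 -> z.1 = 0 -> x.1 != y.1 -> zig x y + zig y z + 1 <= 2 + gauge x z.
Proof.
case: x y z => [a s] [b t] [c r] /= a0 -> ab; rewrite /zig /gauge /= (negbTE ab).
by case: (posnP b) => b0; subst; deceq; lia.
Qed.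

Lemma upl_ge1 x y z : 0 < z.1 -> x.1 = 0 -> z.1 != y.1 -> zig x y + zig y z + 1 <= 2 + gauge x z.
Proof.
case: x y z => [a s] [b t] [c r] /= a0 -> ab; rewrite /zig /gauge /= eq_sym in ab *.
by rewrite (negbTE ab); case: (posnP b) => b0; subst; deceq; lia.
Qed.

(** * Finite sums, and summing the triangles of a strip *)

Definition nsum (N : nat) (f : nat -> nat) : nat := \sum_(i < N) f i.
Arguments nsum : simpl never.

Lemma nsum0 f : nsum 0 f = 0. Proof. exact: big_ord0. Qed.
Lemma nsumS N f : nsum N.+1 f = nsum N f + f N. Proof. exact: big_ord_recr. Qed.
Lemma nsumD N f g : nsum N (fun i => f i + g i) = nsum N f + nsum N g.
Proof. exact: big_split. Qed.
Lemma nsum_eq N f g : (forall i, i < N -> f i = g i) -> nsum N f = nsum N g.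
Proof. by move=> H; apply: eq_bigr => i _; apply: H. Qed.
Lemma nsum_le N f g : (forall i, i < N -> f i <= g i) -> nsum N f <= nsum N g.
Proof. by move=> H; apply: leq_sum => i _; apply: H. Qed.
Lemma nsum_zero N f : (forall i, i < N -> f i = 0) -> nsum N f = 0.
Proof. by move=> H; apply: big1 => i _; apply: H. Qed.
Lemma nsum_const N c : nsum N (fun _ => c) = N * c.
Proof. by rewrite /nsum sum_nat_const card_ord. Qed.
Lemma nsum_swap N M f : nsum N (fun i => nsum M (f i)) = nsum M (fun j => nsum N (fun i => f i j)).
Proof. exact: exchange_big. Qed.
Lemma nsum_ge N f i : i < N -> f i <= nsum N f.
Proof. by move=> iN; rewrite /nsum (bigD1 (Ordinal iN)) //= leq_addr. Qed.
Lemma nsum_delta N i c : nsum N (fun j => (j == i) * c) = (i < N) * c.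
Proof.
elim: N => [|N IH]; first by rewrite nsum0.
by rewrite nsumS IH; case: (ltngtP i N) => h; rewrite ?(gtn_eqF h) ?(ltn_eqF h) ?h ?eqxx; lia.
Qed.

Definition row_gauge (N : nat) (A : nat -> vertex) : nat := nsum N (fun i => gauge (A i) (A i.+1)).

Lemma sum_shift (f : nat -> nat) N : nsum N (fun i => f i.+1) + f 0 = nsum N f + f N.
Proof. by elim: N => [|N IH]; rewrite ?nsum0 // !nsumS; lia. Qed.

(** Every edge between A and C belongs to one triangle of each family, so the [zig] terms cancel up
    to the two ends. These are equal to 1 because the rows are empty there. *)
Lemma strip_sum (A C : nat -> vertex) (N : nat) (wt cb ub : nat -> nat) :
  (A 0).1 = 0 -> (C 0).1 = 0 -> (A N).1 = 0 -> (C N).1 = 0 ->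
  (forall i, i < N -> 2 + gauge (A i) (A i.+1) + cb i
      <= wt i + zig (A i) (C i.+1) + zig (C i.+1) (A i.+1)) ->
  (forall i, i < N -> zig (C i) (A i) + zig (A i) (C i.+1) + ub i <= 2 + gauge (C i) (C i.+1)) ->
  row_gauge N A + nsum N cb + nsum N ub <= nsum N wt + row_gauge N C.
Proof.
move=> A0 C0 AN CN Hc Hu.
have := nsum_le Hc; have := nsum_le Hu; rewrite !nsumD -!/(row_gauge N _).
have := sum_shift (fun i => zig (C i) (A i)) N.
have -> : zig (C 0) (A 0) = 1 by rewrite /zig C0 A0.
have -> : zig (C N) (A N) = 1 by rewrite /zig CN AN.
lia.
Qed.

(* Walking outwards from the last point of C, either the slack sits there or the
   row A must drop below rank l later on, which costs 1 as well. *)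
Lemma walk_right (f : nat -> bool) m N : m <= N -> f N = false ->
  (f m : nat) <= nsum N (fun i => (m <= i) && f i && ~~ f i.+1).
Proof.
move=> mN fN; suff : (f m : nat) <= f N + nsum N (fun i => (m <= i) && f i && ~~ f i.+1) by rewrite fN.
elim: N mN {fN} => [|N IH]; first by case: m => // _; rewrite leq_addr.
rewrite leq_eqVlt => /orP[/eqP->|mN]; first by rewrite leq_addr.
rewrite nsumS; have := IH mN; have -> : m <= N by lia.
by case: (f m); case: (f N); case: (f N.+1) => /=; lia.
Qed.

Lemma walk_left (f : nat -> bool) m N : m <= N -> f 0 = false ->
  (f m : nat) <= nsum N (fun i => (i < m) && ~~ f i && f i.+1).
Proof.
move=> mN f0.
suff H n : (f n : nat) <= nsum n (fun i => (i < m) && ~~ f i && f i.+1) + (f n && (m < n)).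
  elim: N mN => [|N IH]; first by case: m {H} => // _; rewrite f0.
  rewrite leq_eqVlt => /orP[/eqP e|mN]; last by rewrite nsumS; have := IH mN; lia.
  by rewrite -e; have := H m; rewrite ltnn andbF addn0.
elim: n => [|n IH]; first by rewrite f0.
by rewrite nsumS; move: IH; case: (f n); case: (f n.+1) => /=; lia.
Qed.

(** The gain 2 is one unit on each side of C. On the right it sits in the triangle at [m2] if [A m2]
    has rank at most [l], and otherwise in a later cell where A falls to rank at most [l]; the left
    side is symmetric. The flag [df] fixes the left unit in the triangle before [C m1], which frees
    all cells to the left. [ec] and [eu] are slack beyond these two units. *)
Lemma strip_core (A C : nat -> vertex) (N l m1 m2 : nat) (df : bool) (wt ec eu : nat -> nat) :
  (A 0).1 = 0 -> (C 0).1 = 0 -> (A N).1 = 0 -> (C N).1 = 0 ->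
  m1.-1 < N -> m2 < N ->
  (forall i, i < N -> 2 + gauge (A i) (A i.+1) + (ec i +
       ((m2 <= i) && (l < (A i).1) && ~~ (l < (A i.+1).1) +
        ~~ df * ((i < m1.-1) && ~~ (l < (A i).1) && (l < (A i.+1).1))))
      <= wt i + zig (A i) (C i.+1) + zig (C i.+1) (A i.+1)) ->
  (forall i, i < N -> zig (C i) (A i) + zig (A i) (C i.+1) + (eu i +
       ((i == m2) * ~~ (l < (A m2).1) + (i == m1.-1) * (df || ~~ (l < (A m1.-1).1))))
      <= 2 + gauge (C i) (C i.+1)) ->
  row_gauge N A + 2 + nsum N ec + nsum N eu <= nsum N wt + row_gauge N C.
Proof.
move=> A0 C0 AN CN m1N m2N Hc Hu.
have := strip_sum A0 C0 AN CN Hc Hu.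
rewrite !nsumD !nsum_delta m1N m2N.
have := @walk_right (fun i => l < (A i).1) m2 N (ltnW m2N).
have := @walk_left (fun i => l < (A i).1) m1.-1 N (ltnW m1N).
rewrite A0 AN /= => /(_ erefl) W1 /(_ erefl) W2.
case: df {Hc Hu} => /=; first by lia.
rewrite (@nsum_eq N (fun i => ~~ false * _) (fun i => (i < m1.-1) && ~~ (l < (A i).1) && (l < (A i.+1).1))).
  by lia.
by move=> i _; rewrite mul1n.
Qed.

(** Where C stands strictly in front of A on both sides, the two [zig] terms are 1 and already cover
    the constant 2, so a weight equal to the gauge of A suffices. This is the discount for cells
    seen from three sides with the point a - e_1. *)
Lemma strip_ge0 (A C : nat -> vertex) (N : nat) (wt : nat -> nat) :
  (A 0).1 = 0 -> (C 0).1 = 0 -> (A N).1 = 0 -> (C N).1 = 0 ->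
  (forall i, i < N -> strip_weight (A i) (C i.+1) (A i.+1) <= wt i \/
     [/\ (A i).1 < (C i.+1).1, (A i.+1).1 < (C i.+1).1 & gauge (A i) (A i.+1) <= wt i]) ->
  row_gauge N A <= nsum N wt + row_gauge N C.
Proof.
move=> A0 C0 AN CN Hw.
have := @strip_sum A C N wt (fun _ => 0) (fun _ => 0) A0 C0 AN CN.
rewrite !nsum_const !muln0 !addn0; apply => i iN; rewrite addn0.
  case: (Hw i iN) => [w|[a b w]]; first by have := cell_ge0 (A i) (C i.+1) (A i.+1); lia.
  have : zig (A i) (C i.+1) = 1 by rewrite /zig (ltn_eqF a).
  have : zig (C i.+1) (A i.+1) = 1 by rewrite /zig (gtn_eqF b).
  lia.
exact: up_ge0.
Qed.

(** The walks outwards spend their units only where A crosses rank [l]. In a cell with both ranks of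
    A at most [l] the spare unit is therefore still free, and the weight may drop to 1. The choice
    [m1 = m2.+1] serves an empty row C, with a point of A at [m2] in its place. *)
Lemma strip_gain_at (A C : nat -> vertex) (N l m1 m2 : nat) (wt : nat -> nat) :
  (A 0).1 = 0 -> (C 0).1 = 0 -> (A N).1 = 0 -> (C N).1 = 0 ->
  0 < m1 -> m1 <= m2.+1 -> m2 < N ->
  (forall i, i < m1 -> (C i).1 = 0) -> (forall i, m2 < i -> (C i).1 = 0) ->
  (l < (C m2).1) || ((C m2).1 == 0) && (l < (A m2).1) ->
  (l < (C m1).1) || ((C m1).1 == 0) && (l < (A m1.-1).1) ->
  (forall i, i < N -> [\/ strip_weight (A i) (C i.+1) (A i.+1) <= wt i,
     [/\ (A i).1 < (C i.+1).1, (A i.+1).1 < (C i.+1).1 & gauge (A i) (A i.+1) <= wt i] |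
     [/\ (C i.+1).1 = 0, (A i).1 <= l, (A i.+1).1 <= l, (A i).1 != (A i.+1).1 & 0 < wt i]]) ->
  row_gauge N A + 2 <= nsum N wt + row_gauge N C.
Proof.
move=> A0 C0 AN CN m10 m12 m2N Cl Cr H2 H1 Hw.
have m1N : m1.-1 < N by lia.
have := @strip_core A C N l m1 m2 false wt (fun _ => 0) (fun _ => 0) A0 C0 AN CN m1N m2N.
rewrite !nsum_const !muln0 !addn0; apply => i iN; rewrite add0n.
  case: (Hw i iN) => [w|[a b w]|[c a b ab w]].
  - case e1 : (_ && _ && _); case e2 : (_ && _ && _) => /=.
    + by lia.
    + have Cz : (C i.+1).1 = 0 by apply: Cr; lia.
      have ne : (A i).1 != (A i.+1).1 by lia.
      by have := cell_ph_ge1 Cz ne; lia.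
    + have Cz : (C i.+1).1 = 0 by apply: Cl; lia.
      have ne : (A i).1 != (A i.+1).1 by lia.
      by have := cell_ph_ge1 Cz ne; lia.
    + by have := cell_ge0 (A i) (C i.+1) (A i.+1); lia.
  - have h1 : zig (A i) (C i.+1) = 1 by rewrite /zig (ltn_eqF a).
    have h2 : zig (C i.+1) (A i.+1) = 1 by rewrite /zig (gtn_eqF b).
    have e1 : m2 <= i = false by apply/negP => x; rewrite Cr in a; lia.
    have e2 : i < m1.-1 = false by apply/negP => x; rewrite Cl in a; lia.
    by rewrite e1 e2 /=; lia.
  - have h1 : zig (A i) (C i.+1) = 1 by rewrite /zig; case: ifP => //; lia.
    have h2 : zig (C i.+1) (A i.+1) = 1 by rewrite /zig c; case: ifP => //; lia.
    have h3 : gauge (A i) (A i.+1) = 1 by rewrite /gauge (negbTE ab).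
    by lia.
have u0 := up_ge0 (C i) (A i) (C i.+1).
case: (i =P m2) => [e2|ne2]; case: (i =P m1.-1) => [e1|ne1] /=.
- subst m2. have z1 : (C i.+1).1 = 0 by apply: Cr; lia.
  have z2 : (C i).1 = 0 by apply: Cl; lia.
  by move: H2 H1; rewrite -e1 z2; lia.
- subst m2; case e : (l < (A i).1) => /=; first by lia.
  have z1 : (C i.+1).1 = 0 by apply: Cr; lia.
  have p : 0 < (C i).1 by lia.
  have ne : (C i).1 != (A i).1 by lia.
  by have := upr_ge1 p z1 ne; lia.
- rewrite -e1; case e : (l < (A i).1) => /=; first by lia.
  have z1 : (C i).1 = 0 by apply: Cl; lia.
  have em : m1 = i.+1 by lia. subst m1; rewrite /= in H1.
  have p : 0 < (C i.+1).1 by lia.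
  have ne : (C i.+1).1 != (A i).1 by lia.
  by have := upl_ge1 p z1 ne; lia.
- by lia.
Qed.

Lemma first_last (P : pred nat) N m : P m -> (forall i, N <= i -> ~~ P i) ->
  exists m1 m2, [/\ P m1, P m2, m1 <= m2, m2 < N & (forall i, i < m1 -> ~~ P i) /\ (forall i, m2 < i -> ~~ P i)].
Proof.
move=> Pm PN.
have ex : exists i, P i by exists m.
have ub i : P i -> i <= N by move=> Pi; rewrite leqNgt; apply/negP => h; have := PN i (ltnW h); rewrite Pi.
case: (ex_minnP ex) => m1 P1 min1; case: (ex_maxnP ex ub) => m2 P2 max2.
exists m1, m2; split=> //; first exact: min1.
  by rewrite ltnNge; apply/negP => /PN; rewrite P2.
split=> i h; apply/negP => Pi.
  by have := min1 i Pi; lia.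
by have := max2 i Pi; lia.
Qed.

Lemma strip_gain (A C : nat -> vertex) (N l : nat) (wt : nat -> nat) :
  (A 0).1 = 0 -> (C 0).1 = 0 ->
  (forall i, N <= i -> (A i).1 = 0) -> (forall i, N <= i -> (C i).1 = 0) ->
  (forall i, (C i).1 = 0 \/ l < (C i).1) ->
  (exists i, (0 < (C i).1) || (l == 0) && (0 < (A i).1)) ->
  (forall i, i < N -> [\/ strip_weight (A i) (C i.+1) (A i.+1) <= wt i,
     [/\ (A i).1 < (C i.+1).1, (A i.+1).1 < (C i.+1).1 & gauge (A i) (A i.+1) <= wt i] |
     [/\ (C i.+1).1 = 0, (A i).1 <= l, (A i.+1).1 <= l, (A i).1 != (A i.+1).1 & 0 < wt i]]) ->
  row_gauge N A + 2 <= nsum N wt + row_gauge N C.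
Proof.
move=> A0 C0 AN CN Cl ex Hw.
case: (boolP (has (fun i => 0 < (C i).1) (iota 0 N))) => [/hasP[m _ Cm]|/hasPn noC].
  have [||m1 [m2 [P1 P2 m12 m2N [L R]]]] := @first_last (fun i => 0 < (C i).1) N m => //.
    by move=> i /CN ->.
  apply: (@strip_gain_at A C N l m1 m2 wt A0 C0 (AN _ (leqnn _)) (CN _ (leqnn _)) _ _ m2N) => //.
  - by case: m1 P1 {L m12} => //; rewrite C0.
  - by lia.
  - by move=> i /L; lia.
  - by move=> i /R; lia.
  - by case: (Cl m2) => [e|h]; [rewrite e in P2|rewrite h].
  - by case: (Cl m1) => [e|h]; [rewrite e in P1|rewrite h].
have Cz i : (C i).1 = 0.
  case: (leqP N i) => [/CN //|iN].
  by have := noC i; rewrite mem_iota /= add0n iN => /(_ erefl); lia.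
case: ex => m; rewrite Cz /= => /andP[/eqP l0 Am].
have mN : m < N by rewrite ltnNge; apply/negP => /AN; lia.
by apply: (@strip_gain_at A C N l m.+1 m wt A0 C0 (AN _ (leqnn _)) (CN _ (leqnn _))) => //=;
  rewrite ?Cz ?l0 ?Am.
Qed.

(** The two events are places where [cell_top_ge1] and [upr_ge1] apply and which the gain 2 of the
    strip never claims: the first has a point of C in its cell, the second a point of A behind the
    point of C. *)
Definition strip_event_cell (A C : nat -> vertex) t : bool :=
  [&& 0 < (C t).1, (A t).1 == 0 & (A t.-1).1 != (C t).1].
Definition strip_event_up (A C : nat -> vertex) t : bool :=
  [&& 0 < (C t).1, (C t.+1).1 == 0, 0 < (A t).1 & (A t).1 != (C t).1].

(** At the first point of C the preceding triangle has slack of its own, so the left unit can be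
    taken there and no cell further left has to supply it. *)
Definition first_differs (A C : nat -> vertex) t : Prop :=
  exists m, [/\ t < m, 0 < (C m).1, (forall j, j < m -> (C j).1 = 0) & (A m.-1).1 != (C m).1].

Lemma strip_events_at (A C : nat -> vertex) (N m1 m2 : nat) (wt : nat -> nat) :
  (A 0).1 = 0 -> (C 0).1 = 0 -> (A N).1 = 0 -> (C N).1 = 0 ->
  0 < m1 -> m1 <= m2.+1 -> m2 < N ->
  (forall i, i < m1 -> (C i).1 = 0) -> (forall i, m2 < i -> (C i).1 = 0) ->
  (0 < (C m2).1) || (0 < (A m2).1) ->
  (0 < (C m1).1) || (m1 == m2.+1) && (0 < (A m1.-1).1) ->
  (forall i, i < N -> [\/ strip_weight (A i) (C i.+1) (A i.+1) <= wt i,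
     [/\ 0 < (C i.+1).1, (C i.+1).1 < (A i.+1).1, (A i).1 = 0 & 0 < wt i] |
     [/\ (C i.+1).1 = 0, (A i).1 = 0, 0 < (A i.+1).1, first_differs A C i.+1 & 0 < wt i]]) ->
  row_gauge N A + 2 + nsum N (fun i => strip_event_cell A C i.+1) + nsum N (strip_event_up A C) <= nsum N wt + row_gauge N C.
Proof.
move=> A0 C0 AN CN m10 m12 m2N Cl Cr H2 H1 Hw.
have m1N : m1.-1 < N by lia.
apply: (@strip_core A C N 0 m1 m2 ((0 < (C m1).1) && ((A m1.-1).1 != (C m1).1)) wt) => // i iN.
  case: (Hw i iN) => [w|[c ca a w]|[c a a' fd w]].
  - case ec : (strip_event_cell A C i.+1).
      move: ec => /and3P[c /eqP a ne].
      have -> : (m2 <= i) = false by apply/negP => x; rewrite Cr in c; lia.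
      have -> : (i < m1.-1) = false by apply/negP => x; rewrite Cl in c; lia.
      by have := cell_top_ge1 c a ne; rewrite /=; lia.
    case e1 : (_ && _ && _); case e2 : (_ && _ && (_ < _)) => /=; rewrite ?muln0 ?muln1.
    + by lia.
    + have Cz : (C i.+1).1 = 0 by apply: Cr; lia.
      have ne : (A i).1 != (A i.+1).1 by lia.
      by have := cell_ph_ge1 Cz ne; lia.
    + have Cz : (C i.+1).1 = 0 by apply: Cl; lia.
      have ne : (A i).1 != (A i.+1).1 by lia.
      by have := cell_ph_ge1 Cz ne; case: (~~ _); lia.
    + by have := cell_ge0 (A i) (C i.+1) (A i.+1); lia.
  - have h1 : zig (A i) (C i.+1) = 1 by rewrite /zig a (ltn_eqF c).
    have h2 : zig (C i.+1) (A i.+1) = 1 by rewrite /zig (ltn_eqF ca).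
    have h3 : gauge (A i) (A i.+1) = 1 by rewrite /gauge a ltn_eqF //; lia.
    have -> : (m2 <= i) = false by apply/negP => x; rewrite Cr in c; lia.
    have -> : (i < m1.-1) = false by apply/negP => x; rewrite Cl in c; lia.
    have -> : strip_event_cell A C i.+1 = false by apply/negP => /and3P[_ /eqP x _]; lia.
    by rewrite /=; lia.
  - have h1 : zig (A i) (C i.+1) = 1 by rewrite /zig a c.
    have h2 : zig (C i.+1) (A i.+1) = 1 by rewrite /zig c; case: ifP => //; lia.
    have h3 : gauge (A i) (A i.+1) = 1 by rewrite /gauge a ltn_eqF.
    have -> : strip_event_cell A C i.+1 = false by rewrite /strip_event_cell c.
    rewrite a ltnn andbF /=.
    have [m [tm Cm mm ne]] := fd.
    have mE : m = m1.
      case: (ltngtP m m1) => // h; first by rewrite Cl in Cm.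
      have C1 : (C m1).1 = 0 by apply: mm.
      move: H1; rewrite C1 /= => /andP[/eqP e _].
      by rewrite Cr in Cm; lia.
    by rewrite -mE Cm ne /=; lia.
have u0 := up_ge0 (C i) (A i) (C i.+1).
case eu : (strip_event_up A C i).
  move: eu => /and4P[c /eqP z a ne].
  have -> : (i == m1.-1) = false by apply/negP => /eqP x; rewrite Cl in c; lia.
  have ne' : (C i).1 != (A i).1 by lia.
  have := upr_ge1 c z ne'.
  case: (i =P m2) => [<-|_]; rewrite ?a /=; lia.
case: (i =P m2) => [e2|ne2]; case: (i =P m1.-1) => [e1|ne1] /=.
- subst m2. have z2 : (C i).1 = 0 by apply: Cl; lia.
  have z1 : (C m1).1 = 0 by apply: Cr; lia.
  by move: H2; rewrite -e1 z1 z2 /=; lia.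
- subst m2; case e : (0 < (A i).1) => /=; first by lia.
  have z1 : (C i.+1).1 = 0 by apply: Cr; lia.
  have p : 0 < (C i).1 by lia.
  have ne : (C i).1 != (A i).1 by lia.
  by have := upr_ge1 p z1 ne; lia.
- rewrite -e1; have em : m1 = i.+1 by lia. subst m1.
  have p : 0 < (C i.+1).1 by move: H1; lia.
  have z1 : (C i).1 = 0 by apply: Cl; lia.
  rewrite p /=.
  case e : ((A i).1 == (C i.+1).1) => /=; first by rewrite (eqP e) p; lia.
  have ne : (C i.+1).1 != (A i).1 by lia.
  by have := upl_ge1 p z1 ne; lia.
- by lia.
Qed.

Lemma strip_events (A C : nat -> vertex) (N : nat) (wt : nat -> nat) :
  (A 0).1 = 0 -> (C 0).1 = 0 ->
  (forall i, N <= i -> (A i).1 = 0) -> (forall i, N <= i -> (C i).1 = 0) ->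
  (exists i, 0 < (A i).1) ->
  (forall i, i < N -> [\/ strip_weight (A i) (C i.+1) (A i.+1) <= wt i,
     [/\ 0 < (C i.+1).1, (C i.+1).1 < (A i.+1).1, (A i).1 = 0 & 0 < wt i] |
     [/\ (C i.+1).1 = 0, (A i).1 = 0, 0 < (A i.+1).1, first_differs A C i.+1 & 0 < wt i]]) ->
  row_gauge N A + 2 + nsum N (strip_event_cell A C) + nsum N (strip_event_up A C) <= nsum N wt + row_gauge N C.
Proof.
move=> A0 C0 AN CN [m Am] Hw.
have -> : nsum N (strip_event_cell A C) = nsum N (fun i => strip_event_cell A C i.+1).
  have := sum_shift (fun i => strip_event_cell A C i : nat) N.
  have -> : strip_event_cell A C 0 = false by rewrite /strip_event_cell C0.
  have -> : strip_event_cell A C N = false by rewrite /strip_event_cell CN.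
  by rewrite /= !addn0.
have mN : m < N by rewrite ltnNge; apply/negP => /AN; lia.
case: (boolP (has (fun i => 0 < (C i).1) (iota 0 N))) => [/hasP[q _ Cq]|/hasPn noC].
  have [||m1 [m2 [P1 P2 m12 m2N [L R]]]] := @first_last (fun i => 0 < (C i).1) N q => //.
    by move=> i /CN ->.
  apply: (@strip_events_at A C N m1 m2 wt A0 C0 (AN _ (leqnn _)) (CN _ (leqnn _)) _ _ m2N) => //.
  - by case: m1 P1 {L m12} => //; rewrite C0.
  - by lia.
  - by move=> i /L; lia.
  - by move=> i /R; lia.
  - by rewrite P2.
  - by rewrite P1.
have Cz i : (C i).1 = 0.
  case: (leqP N i) => [/CN //|iN].
  by have := noC i; rewrite mem_iota /= add0n iN => /(_ erefl); lia.
by apply: (@strip_events_at A C N m.+1 m wt A0 C0 (AN _ (leqnn _)) (CN _ (leqnn _))) => //=;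
  rewrite ?Cz ?Am ?eqxx.
Qed.

Lemma nsum_pick N a f : nsum N (fun j => (j == a) * f j) = (a < N) * f a.
Proof.
rewrite -(nsum_delta N a (f a)); apply: nsum_eq => i _.
by case: (i =P a) => [->|].
Qed.

Lemma row_gauge_ge2 N A m : (A 0).1 = 0 -> (forall i, N <= i -> (A i).1 = 0) -> 0 < (A m).1 ->
  2 <= row_gauge N A.
Proof.
move=> A0 AN Am.
have mN : m < N by rewrite ltnNge; apply/negP => /AN; lia.
have := @walk_right (fun i => 0 < (A i).1) m N (ltnW mN).
have := @walk_left (fun i => 0 < (A i).1) m N (ltnW mN).
rewrite A0 (AN N) // Am => /(_ erefl) W1 /(_ erefl) W2.
apply: leq_trans (_ : _ <= nsum N (fun i => (m <= i) && (0 < (A i).1) && ~~ (0 < (A i.+1).1) +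
   ((i < m) && ~~ (0 < (A i).1) && (0 < (A i.+1).1)))) _; first by rewrite nsumD; lia.
apply: nsum_le => i _; rewrite /gauge.
case: (posnP (A i).1) => [->|a]; case: (posnP (A i.+1).1) => [->|b]; rewrite ?andbF ?andbT /=; try lia.
all: by case: ifP => //; lia.
Qed.

Lemma row_gauge_ph N A : (forall i, (A i).1 = 0) -> row_gauge N A = 0.
Proof. by move=> A0; apply: nsum_zero => i _; rewrite /gauge !A0. Qed.

(** Strip [j] joins the levels j + 3 and j + 4, whence the offset 4. The margin 10 only keeps all
    index ranges inside [N]. *)
Lemma diag_sum k N (f : nat -> nat -> nat) : k + 10 <= N ->
  (forall u v, f u v != 0 -> 0 < v /\ 4 <= u + v <= k + 4) ->
  nsum k.+1 (fun j => nsum N (fun u => f u (j + 4 - u))) = nsum N (fun u => nsum N (f u)).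
Proof.
move=> kN fz; rewrite nsum_swap; apply: nsum_eq => u uN.
have -> : nsum N (f u) = nsum N (fun v => nsum k.+1 (fun j => (j == u + v - 4) * f u v)).
  apply: nsum_eq => v vN; rewrite (nsum_pick _ _ (fun _ => f u v)).
  case: (posnP (f u v)) => [->|p]; first by rewrite muln0.
  have [|_ h] := fz u v; first by rewrite -lt0n.
  have -> : u + v - 4 < k.+1 by lia.
  by rewrite mul1n.
rewrite nsum_swap; apply: nsum_eq => j jk.
have -> : nsum N (fun v => (j == u + v - 4) * f u v) = nsum N (fun v => (v == j + 4 - u) * f u v).
  apply: nsum_eq => v vN; case: (posnP (f u v)) => [->|p]; first by rewrite !muln0.
  have [|v0 h] := fz u v; first by rewrite -lt0n.
  by congr (nat_of_bool _ * _); apply/eqP/eqP; lia.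
rewrite nsum_pick; case: ltnP => h; first by rewrite mul1n.
by lia.
Qed.

(** * The views along e2 - e3 *)

(* F u v i stands for the value of the diagram at (u, i, v - i) in coordinates
   starting at 1, and cell u v i for the set E of that point. *)
Section Fibre.
Variables (k N : nat) (lam : nat -> nat).

Definition jump w := (4 <= w <= k + 3) && (lam w != lam w.-1).
(** The left view passes from the fibre over (u, v - 1), which is occupied and leftmost on its
    level, to the one over (u, v), which may be empty. *)
Definition leading u v := (4 <= u + v <= k + 4) && (lam (u + v).-1 == u).

Variable F : nat -> nat -> nat -> sgn.

Definition top_pos u v := \max_(j < v | F u v j != S0) j.

Definition cell u v i := face_weight (F u v i) (F u.-1 v i) (F u v.-1 i.-1) (F u v.-1 i).

Definition visible_top u v i := [&& top_pos u v <= i, top_pos u.-1 v <= i & top_pos u v.-1 < i].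

Definition tied w := top_pos (lam w).-1 (w - lam w) == top_pos (lam w) (w - lam w).

(* Cells seen from the left as well: their weight can drop to 1 because the strip
   has a spare unit next to them, except when the next leading column is tied. *)
Definition reduced_top u v i :=
  [&& leading u v, F u v i == S0, F u.-1 v i == S0, F u v.-1 i.-1 != S0, F u v.-1 i == S0
    & (0 < top_pos u v) || jump (u + v) && ~~ tied (u + v)].

Definition weight_top u v i := if visible_top u v i then (if reduced_top u v i then 1 else cell u v i) else 0.

(** The rank is [N] minus the third coordinate. The points a, a - e_1 and a - e_2 seen together in
    this view share that coordinate, hence have equal rank. *)
Definition top_vertex u v : vertex :=
  if top_pos u v == 0 then (0, false) else (N - (v - top_pos u v), F u v (top_pos u v) == SP).

(* Places of a strip with a spare unit; they pay for the cells of thrice below. *)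
Definition event_cell t v := [&& 0 < top_pos t v, top_pos t v.-1 == 0 & top_pos t.-1 v != top_pos t v].
Definition event_up t v := [&& 0 < top_pos t v, top_pos t.+1 v.-1 == 0, 0 < top_pos t v.-1 & (top_pos t v.-1).+1 != top_pos t v].

Hypothesis F0 : forall u v i, F u v i != S0 -> [/\ 0 < u, 0 < i, i < v & u + v <= k + 3].

Lemma top_pos_ge u v j : F u v j != S0 -> j <= top_pos u v.
Proof.
move=> Fj; have [_ _ jv _] := F0 Fj.
exact: (@leq_bigmax_cond _ (fun j : 'I_v => F u v j != S0) (fun j => j : nat) (Ordinal jv) Fj).
Qed.

Lemma top_pos_real u v : 0 < top_pos u v -> F u v (top_pos u v) != S0.
Proof.
rewrite /top_pos; elim/big_rec: _ => // i m Fi IH.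
by rewrite /maxn; case: ifP.
Qed.

Lemma top_pos_gt0 u v j : F u v j != S0 -> 0 < top_pos u v.
Proof. by move=> Fj; have [_ j0 _ _] := F0 Fj; apply: leq_trans j0 (top_pos_ge Fj). Qed.

Lemma top_pos_out u v j : top_pos u v < j -> F u v j = S0.
Proof. by move=> h; apply/eqP; apply: contraTT h => /top_pos_ge; rewrite -leqNgt. Qed.

Lemma top_pos_eq0 u v : (forall j, F u v j = S0) -> top_pos u v = 0.
Proof. by move=> h; case: (posnP (top_pos u v)) => // /top_pos_real; rewrite h. Qed.

Lemma top_pos_dom u v : 0 < top_pos u v -> [/\ 0 < u, top_pos u v < v & u + v <= k + 3].
Proof. by move=> /top_pos_real /F0 []. Qed.

Hypothesis Hlam : forall w, 3 <= w <= k + 3 -> exists i, F (lam w) (w - lam w) i != S0.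
Hypothesis Hlow : forall w u v i, 3 <= w <= k + 3 -> u < lam w -> w <= u + v -> F u v i = S0.

Lemma lam_mono w w' : 3 <= w -> w <= w' -> w' <= k + 3 -> lam w <= lam w'.
Proof.
move=> a b c; rewrite leqNgt; apply/negP => h.
have [|i Fi] := @Hlam w'; first by lia.
have [_ i0 iv _] := F0 Fi.
by move: Fi; rewrite (@Hlow w) //; lia.
Qed.

Lemma lam_dom w : 3 <= w <= k + 3 -> [/\ 0 < lam w, 2 <= w - lam w & 0 < top_pos (lam w) (w - lam w)].
Proof. by move=> /Hlam[i Fi]; have [a b c _] := F0 Fi; split; [|lia|exact: top_pos_gt0 Fi]. Qed.

Lemma top_pos_low w u v : 3 <= w <= k + 3 -> u < lam w -> w <= u + v -> top_pos u v = 0.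
Proof. by move=> a b c; apply: top_pos_eq0 => j; apply: Hlow a b c. Qed.

Lemma leading_dom u v : leading u v ->
  [/\ 0 < u, 2 < v, 0 < top_pos u v.-1 & top_pos u.-1 v = 0].
Proof.
move=> /andP[a /eqP e]; have w3 : 3 <= (u + v).-1 <= k + 3 by lia.
have [p q r] := lam_dom w3; rewrite e in p q r.
split=> //; first by lia.
  by have -> : v.-1 = (u + v).-1 - u by lia.
by apply: (@top_pos_low (u + v).-1); lia.
Qed.

Lemma jump_lt w : jump w -> lam w.-1 < lam w.
Proof. by move=> /andP[a b]; have := @lam_mono w.-1 w; lia. Qed.

Hypothesis kN : k + 10 <= N.

Lemma top_vertex0 u v : ((top_vertex u v).1 == 0) = (top_pos u v == 0).
Proof.
rewrite /top_vertex; case: (posnP (top_pos u v)) => [//|h]; have [_ a b] := top_pos_dom h.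
by rewrite /=; lia.
Qed.

Lemma top_vertex_ph u v : top_pos u v = 0 -> (top_vertex u v).1 = 0.
Proof. by rewrite /top_vertex => ->. Qed.

Lemma top_sign_top_vertex m r u v q : 0 < r -> r < N -> m = N - r -> (top_vertex u v).1 <= m ->
  q = v - r -> top_pos u v <= q /\ top_sign m (top_vertex u v) = F u v q.
Proof.
move=> r0 rN -> + ->; rewrite /top_vertex /top_sign.
case: (posnP (top_pos u v)) => [z|p] /=.
  move=> _; split; first by rewrite z.
  have -> : (0 == N - r) = false by lia.
  case e: (v - r) => [|j] /=; last by rewrite top_pos_out // z.
  by case E : (F u v 0) => //; have [] := @F0 u v 0; rewrite ?E.
have [_ a b] := top_pos_dom p.
move=> le; split; first by lia.
case: eqP => h /=; last by rewrite top_pos_out //; lia.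
have -> : top_pos u v = v - r by lia.
have -> : 0 < N - r by lia.
have := top_pos_real p; have -> : top_pos u v = v - r by lia.
by case: (F u v _).
Qed.

(** The three vertices over a triangle of the strip determine one visible cell, the one of largest
    rank. If its weight was reduced, one of the two exceptional cases of [strip_events] applies. *)
Lemma weight_top_cell w t : 4 <= w <= k + 4 -> 0 < t ->
  [\/ strip_weight (top_vertex t.-1 (w - t)) (top_vertex t (w - t)) (top_vertex t (w - t).-1) <= nsum N (weight_top t (w - t)),
     [/\ 0 < (top_vertex t (w - t)).1, (top_vertex t (w - t)).1 < (top_vertex t (w - t).-1).1,
        (top_vertex t.-1 (w - t)).1 = 0 & 0 < nsum N (weight_top t (w - t))] |
     [/\ (top_vertex t (w - t)).1 = 0, (top_vertex t.-1 (w - t)).1 = 0, 0 < (top_vertex t (w - t).-1).1,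
       first_differs (fun t => top_vertex t (w.-1 - t)) (fun t => top_vertex t (w - t)) t
       & 0 < nsum N (weight_top t (w - t))]].
Proof.
move=> hw t0; set v := w - t.
set m := maxn (top_vertex t.-1 v).1 (maxn (top_vertex t v).1 (top_vertex t v.-1).1).
case: (posnP m) => [m0|m0].
  by constructor 1; rewrite /strip_weight -/m m0 /top_sign !andbF.
have rN u v' : (top_vertex u v').1 < N.
  rewrite /top_vertex; case: eqP => h /=; first by lia.
  by have [|_ a b] := @top_pos_dom u v'; [lia|lia].
have mN : m < N by rewrite /m !gtn_max !rN.
(* [r] and [q] are the third and second coordinates of the cell seen. *)
pose r := N - m; pose q := v - r.
have r0 : 0 < r by lia.
have rN' : r < N by lia.
have mE : m = N - r by lia.
have [||y1 y2] := @top_sign_top_vertex m r t v q r0 rN' mE => //; first by lia.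
have [||p1 p2] := @top_sign_top_vertex m r t.-1 v q r0 rN' mE => //; first by lia.
have [||x1 x2] := @top_sign_top_vertex m r t v.-1 q.-1 r0 rN' mE; rewrite ?/q; try lia.
case: (posnP q) => q0.
  have z : [/\ (top_vertex t v).1 = 0, (top_vertex t.-1 v).1 = 0 & (top_vertex t v.-1).1 = 0].
    by split; apply: top_vertex_ph; move: y1 p1 x1; rewrite /q in q0 *; rewrite q0; lia.
  by case: z => a b c; rewrite /m a b c in m0.
have qN : q < N by lia.
have vertex : visible_top t v q by rewrite /visible_top y1 p1 /=; rewrite /q in q0 *; lia.
have x3 : F t v.-1 q = S0 by apply: top_pos_out; rewrite /q in q0 *; lia.
have cE : strip_weight (top_vertex t.-1 v) (top_vertex t v) (top_vertex t v.-1) = cell t v q.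
  by rewrite /strip_weight -/m y2 p2 x2 /cell x3.
have wE := @nsum_ge N (weight_top t v) q qN.
case rd: (reduced_top t v q); last first.
  by constructor 1; rewrite cE; move: wE; rewrite /weight_top vertex rd.
have wt0 : 0 < nsum N (weight_top t v) by move: wE; rewrite {1}/weight_top vertex rd.
move: rd => /and5P[mn /eqP yz /eqP pz xz /andP[_ alt]].
have [_ v2 Xp Pz] := leading_dom mn.
have xq : top_pos t v.-1 = q.-1 by apply/eqP; rewrite eqn_leq x1 (top_pos_ge xz).
have Ap : (top_vertex t v.-1).1 = N - r.
  rewrite /top_vertex; have -> /= : top_pos t v.-1 == 0 = false by lia.
  by rewrite xq /q in q0 *; lia.
have Bp : (top_vertex t.-1 v).1 = 0 by apply: top_vertex_ph.
(* If column [t] has ended, the first point of level [w] is in column [lam w], and being untied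
   there is what [first_differs] asks. Otherwise the column continues further back than a - e_2, and
   the second case applies. *)
case: (posnP (top_pos t v)) => [z|Yp].
  move: alt; rewrite z /= => /andP[jp tie].
  have e : t + v = w by rewrite /v in v2 *; lia.
  rewrite e in jp tie.
  have jl := jump_lt jp.
  have te : lam w.-1 = t by move: mn => /andP[_ /eqP]; rewrite e.
  have w3 : 3 <= w <= k + 3 by move: jp => /andP[]; lia.
  have [a b c] := lam_dom w3.
  constructor 3; split=> //; [exact: top_vertex_ph|lia|].
  exists (lam w); split; [lia| by have := top_vertex0 (lam w) (w - lam w); lia | |].
    by move=> j jl'; apply: top_vertex_ph; apply: (@top_pos_low w); lia.
  have -> : w.-1 - (lam w).-1 = w - lam w by lia.
  move: tie; rewrite /tied /top_vertex.
  have -> /= : top_pos (lam w) (w - lam w) == 0 = false by lia.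
  have [_ h1 h2] := top_pos_dom c.
  case: (posnP (top_pos (lam w).-1 (w - lam w))) => [->|h] /=; first by lia.
  by have [_ h3 h4] := top_pos_dom h; lia.
constructor 2; split=> //; first by have := top_vertex0 t v; lia.
have [_ h1 h2] := top_pos_dom Yp.
rewrite Ap /top_vertex; have -> /= : top_pos t v == 0 = false by lia.
have : top_pos t v != q by apply/eqP => h; move: (top_pos_real Yp); rewrite h yz.
by rewrite /q in y1 *; lia.
Qed.

Lemma top_vertex_col0 v : (top_vertex 0 v).1 = 0.
Proof. by apply: top_vertex_ph; case: (posnP (top_pos 0 v)) => // /top_pos_dom[]. Qed.

Lemma top_vertex_big u v : k + 3 < u + v -> (top_vertex u v).1 = 0.
Proof. by move=> h; apply: top_vertex_ph; case: (posnP (top_pos u v)) => // /top_pos_dom[]; lia. Qed.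

Lemma top_vertex_col u v : N <= u -> (top_vertex u v).1 = 0.
Proof. by move=> h; apply: top_vertex_big; lia. Qed.

Lemma top_vertex_neq u v u' v' r : 0 < top_pos u v -> 0 < top_pos u' v' ->
  v = v' + r -> ((top_vertex u v).1 == (top_vertex u' v').1) = (top_pos u v == top_pos u' v' + r).
Proof.
move=> a b; rewrite /top_vertex; case: (posnP (top_pos u v)) a => // a _; case: (posnP (top_pos u' v')) b => // b _ -> /=.
have [_ p q] := top_pos_dom a; have [_ p' q'] := top_pos_dom b.
by apply/eqP/eqP; lia.
Qed.

Lemma weight_top_level w : 4 <= w <= k + 4 ->
  row_gauge N (fun t => top_vertex t (w.-1 - t)) + 2 + nsum N (fun t => event_cell t (w - t) + event_up t (w - t))
  <= nsum N (fun t => nsum N (weight_top t.+1 (w - t.+1))) + row_gauge N (fun t => top_vertex t (w - t)).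
Proof.
move=> hw; rewrite nsumD.
set A := fun t => top_vertex t (w.-1 - t); set C := fun t => top_vertex t (w - t).
have [p q r] := @lam_dom w.-1 ltac:(lia).
have ex : exists i, 0 < (A i).1.
  by exists (lam w.-1); have := top_vertex0 (lam w.-1) (w.-1 - lam w.-1); rewrite /A; lia.
have key : row_gauge N A + 2 + nsum N (strip_event_cell A C) + nsum N (strip_event_up A C)
    <= nsum N (fun t => nsum N (weight_top t.+1 (w - t.+1))) + row_gauge N C.
  apply: strip_events => //; try exact: top_vertex_col0; try by move=> i; apply: top_vertex_col.
  move=> i _; rewrite /A /C; have -> : w.-1 - i = w - i.+1 by lia.
  have -> : w.-1 - i.+1 = (w - i.+1).-1 by lia.
  exact: (@weight_top_cell w i.+1 hw isT).
move: key; suff -> : nsum N (strip_event_cell A C) = nsum N (fun t => event_cell t (w - t)).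
  suff -> : nsum N (strip_event_up A C) = nsum N (fun t => event_up t (w - t)) by lia.
  apply: nsum_eq => t _; congr nat_of_bool; rewrite /strip_event_up /event_up /A /C.
  have -> : w - t.+1 = (w - t).-1 by lia.
  have -> : w.-1 - t = (w - t).-1 by lia.
  rewrite !lt0n !top_vertex0; case: (posnP (top_pos t (w - t))) => //= a.
  case: (posnP (top_pos t (w - t).-1)) => [_|b] /=; first by rewrite !andbF.
  have [_ c d] := top_pos_dom a.
  have E := @top_vertex_neq t (w - t) t (w - t).-1 1 a b ltac:(lia).
  by rewrite [(top_vertex t (w - t).-1).1 == _]eq_sym E addn1 [_ == (top_pos _ _).+1]eq_sym.
apply: nsum_eq => t _; congr nat_of_bool; rewrite /strip_event_cell /event_cell /A /C.
have -> : w.-1 - t = (w - t).-1 by lia.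
rewrite !lt0n !top_vertex0; case: (posnP (top_pos t (w - t))) => //= a.
have [t0 c d] := top_pos_dom a.
have -> : w.-1 - t.-1 = w - t by lia.
case: (_ == 0) => //=.
case: (posnP (top_pos t.-1 (w - t))) => [z|b].
  rewrite top_vertex_ph // z; have := top_vertex0 t (w - t); lia.
by rewrite (@top_vertex_neq _ _ _ _ 0) ?addn0.
Qed.

(** There are k + 1 strips with gain 2 each. A further 2 is the gauge of the nonempty level 3, while
    level k + 4 is empty and has gauge 0. *)
Lemma weight_top_total :
  2 * (k + 2) + nsum k.+1 (fun j => nsum N (fun t => event_cell t (j + 4 - t) + event_up t (j + 4 - t)))
  <= nsum k.+1 (fun j => nsum N (fun t => nsum N (weight_top t.+1 (j + 4 - t.+1)))).
Proof.
pose G w := row_gauge N (fun t => top_vertex t (w - t)).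
suff H n : n <= k.+1 -> G 3 + 2 * n + nsum n (fun j => nsum N (fun t => event_cell t (j + 4 - t) + event_up t (j + 4 - t)))
   <= nsum n (fun j => nsum N (fun t => nsum N (weight_top t.+1 (j + 4 - t.+1)))) + G (n + 3).
  have := H _ (leqnn k.+1).
  have -> : G (k.+1 + 3) = 0.
    by apply: row_gauge_ph => t; case: (leqP t (k + 4)) => h; apply: top_vertex_big; lia.
  suff : 2 <= G 3 by lia.
  have [a b c] := @lam_dom 3 ltac:(lia).
  apply: (@row_gauge_ge2 N _ (lam 3)); first exact: top_vertex_col0.
    by move=> i; apply: top_vertex_col.
  by have := top_vertex0 (lam 3) (3 - lam 3); rewrite /=; lia.
elim: n => [|n IH] nk; first by rewrite !nsum0 muln0 !addn0 !add0n.
rewrite !nsumS; have := IH (ltnW nk).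
have := @weight_top_level (n + 4) ltac:(lia).
have -> : (n + 4).-1 = n + 3 by lia.
rewrite -/(G _) -/(G _) addSn -addnS; lia.
Qed.
End Fibre.

(** * The left view *)

Section LeftView.
Variables (k N : nat) (lam : nat -> nat) (F : nat -> nat -> nat -> sgn).
Hypothesis kN : k + 10 <= N.
Hypothesis F0 : forall u v i, F u v i != S0 -> [/\ 0 < u, 0 < i, i < v & u + v <= k + 3].
Hypothesis Hlam : forall w, 3 <= w <= k + 3 -> exists i, F (lam w) (w - lam w) i != S0.
Hypothesis Hlow : forall w u v i, 3 <= w <= k + 3 -> u < lam w -> w <= u + v -> F u v i = S0.

Definition weight_left u v i := if leading k lam u v then cell F u v i else 0.

(** Nothing lies to the left of a leading column on its level, so no point is hidden and the ranks
    are just 0 and 1. *)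
Definition fibre u v i : vertex := (F u v i != S0 : nat, F u v i == SP).

Lemma fibre_ph u v i : F u v i = S0 -> (fibre u v i).1 = 0.
Proof. by rewrite /fibre => ->. Qed.

Lemma fibre_i0 u v : F u v 0 = S0.
Proof. by case E : (F u v 0) => //; have [] := @F0 u v 0; rewrite ?E. Qed.

Lemma fibre_out u v i : N <= i \/ k + 3 < u + v -> F u v i = S0.
Proof.
move=> h; apply/eqP; apply/negPn/negP => /F0[]; lia.
Qed.

Lemma weight_left_strip u v : leading k lam u v ->
  row_gauge N (fibre u v.-1) + 2 <= nsum N (fun i => weight_left u v i.+1) + row_gauge N (fibre u v).
Proof.
move=> mn; have [u0 v2 X P] := leading_dom F0 Hlam Hlow mn.
have p0 i : F u.-1 v i = S0 by case: i => [|i]; [exact: fibre_i0 | apply: (top_pos_out F0); rewrite P].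
apply: (@strip_gain _ _ N 0) => //.
- by apply: fibre_ph; apply: fibre_i0.
- by apply: fibre_ph; apply: fibre_i0.
- by move=> i h; apply: fibre_ph; apply: fibre_out; left.
- by move=> i h; apply: fibre_ph; apply: fibre_out; left.
- by move=> i; case: (posnP (fibre u v i).1) => [->|h]; [left|right].
- exists (top_pos F u v.-1); rewrite eqxx /= /fibre /=.
  by rewrite (top_pos_real X) orbT.
move=> i _; constructor 1; rewrite /weight_left mn /cell p0 /strip_weight /fibre /=.
by case: (F u v i.+1); case: (F u v.-1 i); case: (F u v.-1 i.+1).
Qed.

(** At a jump the old column is empty on the new level and its row has gauge 0, whereas the new
    leading column is occupied and has gauge at least 2. The difference is the extra 2 for each
    jump. *)
Lemma weight_left_total :
  2 * (k + 2) + 2 * nsum k.+1 (fun j => jump k lam (j + 4))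
  <= nsum k.+1 (fun j => nsum N (fun u => nsum N (fun i => weight_left u (j + 4 - u) i.+1))).
Proof.
pose L w := nsum N (fun u => nsum N (fun i => weight_left u (w - u) i.+1)).
pose X w := row_gauge N (fibre (lam w) (w - lam w)).
pose B w := row_gauge N (fibre (lam w.-1) (w - lam w.-1)).
have LB w : 4 <= w <= k + 4 -> X w.-1 + 2 <= L w + B w.
  move=> hw; have [a b c] := lam_dom F0 Hlam (w := w.-1) ltac:(lia).
  have e : lam w.-1 + (w - lam w.-1) = w by lia.
  have mn : leading k lam (lam w.-1) (w - lam w.-1) by rewrite /leading e eqxx; lia.
  have := weight_left_strip mn; rewrite -/(B w).
  have -> : (w - lam w.-1).-1 = w.-1 - lam w.-1 by lia.
  rewrite -/(X _).
  have := @nsum_ge N (fun u => nsum N (fun i => weight_left u (w - u) i.+1)) (lam w.-1) ltac:(lia).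
  by rewrite -/(L w) /=; lia.
have X2 w : 3 <= w <= k + 3 -> 2 <= X w.
  move=> hw; have [a b c] := lam_dom F0 Hlam hw.
  apply: (@row_gauge_ge2 N _ (top_pos F (lam w) (w - lam w))).
  - by apply: fibre_ph; apply: fibre_i0.
  - by move=> i h; apply: fibre_ph; apply: fibre_out; left.
  - by rewrite /fibre /= (top_pos_real c).
have BX w : 4 <= w <= k + 3 -> B w + 2 * jump k lam w <= X w.
  move=> hw; case j : (jump k lam w).
    have := jump_lt F0 Hlam Hlow j => lt.
    have -> : B w = 0.
      apply: row_gauge_ph => i; apply: fibre_ph; apply: (@Hlow w); lia.
    by have := X2 w; lia.
  move: j; rewrite /jump hw /= => /negbFE/eqP e.
  by rewrite /B /X e; lia.
have H n : n <= k -> X 3 + 2 * n + 2 * nsum n (fun j => jump k lam (j + 4)) <= nsum n (fun j => L (j + 4)) + X (n + 3).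
  elim: n => [|n IH] nk; first by rewrite !nsum0 muln0 !addn0 !add0n.
  rewrite !nsumS; have := IH (ltnW nk); have := LB (n + 4) ltac:(lia); have := BX (n + 4) ltac:(lia).
  have -> : (n + 4).-1 = n + 3 by lia.
  by rewrite addSn -addnS; lia.
have := H k (leqnn k); have := X2 3 ltac:(lia); have := LB (k + 4) ltac:(lia).
have -> : (k + 4).-1 = k + 3 by lia.
have -> : B (k + 4) = 0.
  apply: row_gauge_ph => i; apply: fibre_ph; apply: fibre_out; right.
  have -> : (k + 4).-1 = k + 3 by lia.
  by have [a b c] := lam_dom F0 Hlam (w := k + 3) ltac:(lia); lia.
have -> : nsum k.+1 (fun j => jump k lam (j + 4)) = nsum k (fun j => jump k lam (j + 4)).
  rewrite nsumS; have -> : jump k lam (k + 4) = false by apply/negP => /andP[]; lia.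
  by rewrite addn0.
by move=> h1 h2 h3; rewrite -[X in _ <= X]/(nsum k.+1 (fun j => L (j + 4))) nsumS; lia.
Qed.
End LeftView.

(** * The right view *)

(* In row v the rank of a point of column u is u + 1, in row v - 1 it is u: this is
   the first coordinate of the cell in which it is seen. *)
Definition raise (x : vertex) : vertex := if x.1 == 0 then x else (x.1.+1, x.2).

Lemma gauge_raise x y : gauge (raise x) (raise y) = gauge x y.
Proof.
case: x y => [[|a] s] [[|b] t] //=.
Qed.

Lemma row_gauge_raise N A : row_gauge N (fun i => raise (A i)) = row_gauge N A.
Proof. by apply: nsum_eq => i _; rewrite gauge_raise. Qed.

Section RightView.
Variables (k N : nat) (lam : nat -> nat) (F : nat -> nat -> nat -> sgn).
Hypothesis F0 : forall u v i, F u v i != S0 -> [/\ 0 < u, 0 < i, i < v & u + v <= k + 3].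

Fixpoint profile (v lo hi i : nat) : vertex :=
  if hi is h.+1 then
    if (lo <= h) && (F h v i != S0) then (h, F h v i == SP) else profile v lo h i
  else (0, false).

Lemma profileP v lo hi i :
  let x := profile v lo hi i in
  (x.1 = 0 /\ forall s, lo <= s -> s < hi -> F s v i = S0) \/
  [/\ 0 < x.1, lo <= x.1, x.1 < hi, F x.1 v i != S0 & x.2 = (F x.1 v i == SP) /\
    forall s, x.1 < s -> s < hi -> F s v i = S0].
Proof.
elim: hi => [|h IH] /=; first by left; split=> // s _; rewrite ltn0.
case: ifP => [/andP[a b]|nab] /=.
  right; have [h0 _ _ _] := F0 b; split=> //; split=> // s; lia.
case: IH => [[z H]|[a b c d [e H]]].
  left; split=> // s ls; rewrite ltnS leq_eqVlt => /orP[/eqP e|]; last exact: H.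
  by subst s; move: nab; rewrite ls /= => /negbFE/eqP.
right; split=> //; first by lia.
split=> // s xs; rewrite ltnS leq_eqVlt => /orP[/eqP es|]; last exact: H.
subst s; move: nab; have -> : lo <= h by lia.
by move=> /= /negbFE/eqP.
Qed.

Lemma profile_ge v lo hi i s : lo <= s -> s < hi -> F s v i != S0 -> s <= (profile v lo hi i).1.
Proof.
move=> a b c; case: (profileP v lo hi i) => [[_ H]|[_ _ _ _ [_ H]]].
  by rewrite H in c.
by rewrite leqNgt; apply/negP => h; rewrite H in c.
Qed.

Lemma profile_i0 v lo hi : (profile v lo hi 0).1 = 0.
Proof. by case: (profileP v lo hi 0) => [[]//|[_ _ _ /F0[]]]; rewrite ltnn. Qed.

Lemma profile_out v lo hi i : k + 10 <= N -> N <= i -> (profile v lo hi i).1 = 0.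
Proof. by move=> kN Ni; case: (profileP v lo hi i) => [[]//|[_ _ _ /F0[]]]; lia. Qed.

Lemma profile_split v lo l hi i : lo <= l -> l <= hi ->
  profile v lo hi i = if (profile v l hi i).1 == 0 then profile v lo l i else profile v l hi i.
Proof.
move=> a; elim: hi => [|h IH] lh.
  by have -> : l = 0 by lia.
move: lh; rewrite leq_eqVlt => /orP[/eqP e|lh].
  subst l; case: (profileP v h.+1 h.+1 i) => [[-> _]|[_ p q _ _]] //; lia.
rewrite /=; have -> : lo <= h by lia. have -> : l <= h by lia.
case: ifP => [/= Fh|_]; last exact: IH.
by have [h0 _ _ _] := F0 Fh; rewrite /= gtn_eqF.
Qed.

(** On an edge with a point of the right part at either end, the whole profile has the gauge of the
    right part alone, so the gauge of the left part is gained. A tie makes the left part change rank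
    on such an edge, since column [l.-1] is its frontmost one: after [q] for [t], before [q'] for
    [t']. The condition [q' <= q] keeps the two edges distinct. *)
Lemma profile_cut_gain v lo l hi q q' (t t' : bool) : k + 10 <= N ->
  lo < l -> l < hi ->
  (t -> [/\ F l v q != S0, F l.-1 v q != S0 & F l.-1 v q.+1 = S0]) ->
  (t' -> [/\ F l v q' != S0, F l.-1 v q' != S0 & F l.-1 v q'.-1 = S0]) ->
  (t -> t' -> q' <= q) ->
  row_gauge N (profile v lo hi) + (t + t') <= row_gauge N (profile v lo l) + row_gauge N (profile v l hi).
Proof.
move=> kN lol lhi Ht Ht' qq.
have qN : t -> q < N by move=> /Ht[/F0[]]; lia.
have qN' : t' -> 0 < q' /\ q' < N by move=> /Ht'[/F0[]]; lia.
have -> : t + t' = nsum N (fun i => (i == q) * t) + nsum N (fun i => (i == q'.-1) * t').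
  rewrite !nsum_delta; case: t qN {Ht qq} => [/(_ isT) h|_]; case: t' qN' {Ht'} => [/(_ isT) h'|_].
  - rewrite h; have -> : q'.-1 < N by lia. by [].
  - by rewrite h !muln0.
  - have -> : q'.-1 < N by lia. by rewrite muln0.
  - by rewrite !muln0.
rewrite -!nsumD; apply: nsum_le => i iN.
set L := profile v lo l; set R := profile v l hi.
have SE j : profile v lo hi j = if (R j).1 == 0 then L j else R j by apply: profile_split; lia.
have LR j : (L j).1 < l.
  by rewrite /L; case: (profileP v lo l j) => [[-> _]|[]]; lia.
have RL j : (R j).1 = 0 \/ l <= (R j).1.
  by rewrite /R; case: (profileP v l hi j) => [[-> _]|[]]; [left|right].
have top j : F l.-1 v j != S0 -> (L j).1 = l.-1.
  move=> h; have : l.-1 <= (L j).1 by apply: profile_ge => //; lia.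
  by have := LR j; rewrite /L in h *; lia.
have ntop j : F l.-1 v j = S0 -> 0 < l.-1 -> (L j).1 != l.-1.
  move=> h l0; rewrite /L; case: (profileP v lo l j) => [[-> _]|[_ _ _ z _]]; first by lia.
  by apply/eqP => e; move: z; rewrite e h.
have Rr j : F l v j != S0 -> 0 < (R j).1.
  move=> h; have [l0 _ _ _] := F0 h; have : l <= (R j).1 by apply: profile_ge.
  by lia.
have ext : (i == q) * t + (i == q'.-1) * t' <= ((0 < (R i).1) || (0 < (R i.+1).1)) * gauge (L i) (L i.+1).
  have gle : (i == q) && t || (i == q'.-1) && t' -> 1 <= ((0 < (R i).1) || (0 < (R i.+1).1)) * gauge (L i) (L i.+1).
    case/orP => /andP[/eqP -> tt].
      have [a b c] := Ht tt; have [l0 _ _ _] := F0 b.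
      rewrite Rr //= mul1n /gauge (top _ b) eq_sym.
      by rewrite (negbTE (ntop _ c l0)).
    have [a b c] := Ht' tt; have [l0 q0 _ _] := F0 b.
    have e : q'.-1.+1 = q' by lia.
    rewrite e (Rr q') // orbT mul1n /gauge (top _ b).
    by rewrite (negbTE (ntop _ c l0)).
  have nb : ~~ ((i == q) && t && ((i == q'.-1) && t')).
    apply/negP => /andP[/andP[/eqP e1 tt] /andP[/eqP e2 tt']].
    by have := qq tt tt'; have := qN' tt'; lia.
  move: gle nb; case: (i == q); case: (i == q'.-1); case: (t); case: (t') => //= h _; apply: h.
apply: leq_trans (leq_add (leqnn _) ext) _; rewrite !SE.
move: (LR i) (LR i.+1) (RL i) (RL i.+1); rewrite /gauge.
move: (L i) (L i.+1) (R i) (R i.+1) => [x1 s1] [x2 s2] [y1 r1] [y2 r2] /=.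
move=> l1 l2 r1' r2'.
case: (posnP y1) r1' => [->|a] r1'; case: (posnP y2) r2' => [->|b] r2'; rewrite /= ?mul0n ?mul1n; try lia.
- by deceq; lia.
- by deceq; lia.
- by rewrite a addnC.
Qed.
End RightView.

(** * Right view: clusters of columns within one row *)

Section Clusters.
Variables (k N : nat) (lam : nat -> nat) (F : nat -> nat -> nat -> sgn).
Variable thrice : nat -> nat -> nat -> bool.
Hypothesis F0 : forall u v i, F u v i != S0 -> [/\ 0 < u, 0 < i, i < v & u + v <= k + 3].
Hypothesis Hlam : forall w, 3 <= w <= k + 3 -> exists i, F (lam w) (w - lam w) i != S0.
Hypothesis Hlow : forall w u v i, 3 <= w <= k + 3 -> u < lam w -> w <= u + v -> F u v i = S0.
Hypothesis HT : forall u v i, thrice u v i -> F u v.-1 i.-1 = S0 /\ F u v.-1 i = S0.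

(* Once the leading column l starts, at row v, column l - 1 is empty in all higher
   rows, so that the rows can be cut in front of l. *)
Definition new_separator l v := jump k lam (l + v) && (lam (l + v) == l).
Definition separator v l := (l == 1) || has (new_separator l) (iota 0 v).

Fixpoint cluster_start v n := if n is m.+1 then (if separator v m then m else cluster_start v m) else 0.
Definition cluster_end v u := u.+1 + find (separator v) (iota u.+1 (N - u.+1)).

Definition reduced_right u v i :=
  [&& leading k lam u v, 0 < top_pos F u v, F u v i == S0 & (F u v.-1 i.-1 != S0) (+) (F u v.-1 i != S0)].

(** The test on [u] says that the cell is the one seen from the right over its triangle. The two
    discounts are those allowed by the second and third alternatives of [strip_gain]. *)
Definition weight_right v u i :=
  let A j := profile F v.-1 (cluster_start v u.+1) (cluster_end v u) j in
  let C j := raise (profile F v (cluster_start v u.+1) (cluster_end v u) j) in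
  if u == maxn (A i.-1).1 (maxn (C i).1 (A i).1) then
    (if thrice u v i then gauge (A i.-1) (A i) else if reduced_right u v i then 1 else cell F u v i)
  else 0.

Lemma new_separator_dom l v : new_separator l v -> [/\ 0 < l, 2 <= v, 4 <= l + v <= k + 3 & lam (l + v) = l].
Proof.
move=> /andP[/andP[a _] /eqP e].
by have [b c _] := lam_dom F0 Hlam (w := l + v) ltac:(lia); rewrite e in b c; split=> //; lia.
Qed.

Lemma separatorP v l : reflect (l = 1 \/ exists v', v' < v /\ new_separator l v') (separator v l).
Proof.
apply: (iffP orP) => -[].
- by move=> /eqP; left.
- by move=> /hasP[v']; rewrite mem_iota /= add0n => h n; right; exists v'.
- by move=> ->; left.
- by move=> [v' [h n]]; right; apply/hasP; exists v' => //; rewrite mem_iota.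
Qed.

Lemma separator_gt0 v l : separator v l -> 0 < l.
Proof. by move=> /separatorP[->//|[v' [_ /new_separator_dom[]]]]. Qed.

Lemma separator_empty v l v' i : separator v l -> v <= v' -> F l.-1 v' i = S0.
Proof.
move=> /separatorP[->|[q [qv /new_separator_dom[a b c d]]]] vv.
  by apply/eqP; apply/negPn/negP => /F0[].
by apply: (@Hlow (l + q)); lia.
Qed.

Lemma lam_start w : 3 <= w -> w <= k + 3 -> lam w = 1 \/ exists w', [/\ w' <= w, jump k lam w' & lam w' = lam w].
Proof.
elim: w => // w IH; rewrite leq_eqVlt => /orP[/eqP <- h|w3 wk].
  by left; have [a b _] := lam_dom F0 Hlam (w := 3) ltac:(lia); lia.
case: (lam w.+1 =P lam w) => [->|ne].
  case: IH; [lia|lia|by left|move=> [w' [a b c]]]; right; exists w'; split=> //; lia.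
by right; exists w.+1; split=> //; rewrite /jump; apply/andP; split; [lia|exact/eqP].
Qed.

(** A leading column is 1 or started at a jump on an earlier level, that is in a lower row. Hence a
    cluster contains at most one leading column, and it is the first of the cluster. *)
Lemma leading_sep u v : leading k lam u v -> separator v u.
Proof.
move=> mn; have [u0 v2 _ _] := leading_dom F0 Hlam Hlow mn.
move: mn => /andP[a /eqP e]; apply/separatorP.
case: (@lam_start (u + v).-1); [lia|lia|by left; lia|move=> [w' [b c d]]].
right; exists (w' - u); have w'3 : 3 <= w' <= k + 3 by move: c => /andP[]; lia.
have [p q _] := lam_dom F0 Hlam w'3.
split; first by lia.
rewrite /new_separator; have -> : u + (w' - u) = w' by lia.
by rewrite c d e eqxx.
Qed.

Lemma cluster_start_le v n : cluster_start v n <= n.-1.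
Proof. by elim: n => //= n IH; case: ifP; lia. Qed.

Lemma cluster_start_sep v n : cluster_start v n = 0 \/ separator v (cluster_start v n).
Proof. by elim: n => [|n IH] /=; [left | case: ifP; [right|]]. Qed.

Lemma cluster_start_gap v n s : cluster_start v n < s -> s < n -> separator v s = false.
Proof.
elim: n => //= n IH; case: ifP => [_|h] a; rewrite ltnS; first by lia.
by rewrite leq_eqVlt => /orP[/eqP->//|]; apply: IH.
Qed.

Lemma cluster_start_eq v n u : cluster_start v n <= u -> u < n -> cluster_start v u.+1 = cluster_start v n.
Proof.
elim: n => //= n IH; case: ifP => h a.
  rewrite ltnS => b; have -> : u = n by lia.
  by rewrite /= h.
rewrite ltnS leq_eqVlt => /orP[/eqP->|b]; first by rewrite /= h.
exact: IH.
Qed.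

Lemma cluster_end_eq v n u : n <= N -> u < n -> (n = N \/ separator v n) ->
  (forall s, u < s -> s < n -> separator v s = false) -> cluster_end v u = n.
Proof.
move=> nN un Hn gap; rewrite /cluster_end.
have -> : N - u.+1 = (n - u.+1) + (N - n) by lia.
rewrite iotaD find_cat.
have -> : has (separator v) (iota u.+1 (n - u.+1)) = false.
  by apply/negP => /hasP[s]; rewrite mem_iota => h; rewrite gap; lia.
rewrite size_iota; have -> : u.+1 + (n - u.+1) = n by lia.
case: Hn => [->|sn]; first by rewrite subnn /=; lia.
case e : (N - n) => [|m] /=; first by lia.
by rewrite sn; lia.
Qed.

Hypothesis kN : k + 10 <= N.

Section OneCluster.
Variables (v lo hi : nat).
Hypothesis lohi : lo < hi.
Hypothesis hiN : hi <= N.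
Hypothesis seplo : lo = 0 \/ separator v lo.
Hypothesis sephi : hi = N \/ separator v hi.
Hypothesis Hlst : forall u, lo <= u -> u < hi -> cluster_start v u.+1 = lo.
Hypothesis Hnxt : forall u, lo <= u -> u < hi -> cluster_end v u = hi.

Let A i := profile F v.-1 lo hi i.
Let C i := raise (profile F v lo hi i).
Definition interval_sum lo hi (f : nat -> nat) := nsum N (fun u => ((lo <= u) && (u < hi)) * f u).
Let wt i := interval_sum lo hi (fun u => weight_right v u i.+1).

Lemma col_lo i : F lo.-1 v i = S0.
Proof.
case: seplo => [->|s]; last exact: separator_empty s (leqnn _).
by apply/eqP; apply/negPn/negP => /F0[].
Qed.

(** Needed because [raise] would send a point of this column to rank [hi], outside the cluster. *)
Lemma col_hi i : F hi.-1 v i = S0.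
Proof.
case: sephi => [->|s]; last exact: separator_empty s (leqnn _).
by apply/eqP; apply/negPn/negP => /F0[]; lia.
Qed.

(** The largest rank [m] is the column of the cell seen; the point of that cell in row [v] and
    column [m] must be missing, since [raise] would give it rank m + 1. *)
Lemma cluster_cell i : let m := maxn (A i).1 (maxn (C i.+1).1 (A i.+1).1) in
  0 < m -> [/\ lo <= m, m < hi, F m v i.+1 = S0,
     strip_weight (A i) (C i.+1) (A i.+1) = cell F m v i.+1 &
     [/\ F m v.-1 i = S0 -> (A i).1 < m, F m v.-1 i.+1 = S0 -> (A i.+1).1 < m,
         F m v.-1 i != S0 -> (A i).1 = m & F m v.-1 i.+1 != S0 -> (A i.+1).1 = m]].
Proof.
move=> m m0.
have Ab j : (A j).1 = 0 \/ (lo <= (A j).1 < hi).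
  rewrite /A; case: (profileP F0 v.-1 lo hi j) => [[z _]|[_ a b _ _]]; first by left.
  by right; rewrite a b.
have Cb j : (C j).1 = 0 \/ (lo < (C j).1 < hi).
  rewrite /C /raise; case: (profileP F0 v lo hi j) => [[z _]|[a b c d _]]; first by left; rewrite z eqxx z.
  right; rewrite (gtn_eqF a) /=.
  suff : (profile F v lo hi j).1 != hi.-1 by lia.
  by apply/eqP => e; move: d; rewrite e col_hi.
have mlo : lo <= m.
  by move: (Ab i) (Ab i.+1) (Cb i.+1); rewrite /m in m0 *; lia.
have mhi : m < hi.
  by move: (Ab i) (Ab i.+1) (Cb i.+1); rewrite /m in m0 *; lia.
have Ai : (A i).1 <= m by rewrite /m; lia.
have At : (A i.+1).1 <= m by rewrite /m; lia.
have Ct : (C i.+1).1 <= m by rewrite /m; lia.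
have y0 : F m v i.+1 = S0.
  apply/eqP; apply/negPn/negP => h.
  have := @profile_ge k F F0 v lo hi i.+1 m mlo mhi h.
  by move: Ct; rewrite /C /raise; case: eqP => /=; lia.
have mskA j : (A j).1 <= m -> top_sign m (A j) = F m v.-1 j.
  rewrite /top_sign m0 andbT /A => le.
  case: (profileP F0 v.-1 lo hi j) => [[z H]|[a b c d [-> H]]].
    by rewrite z (ltn_eqF m0) H.
  case: eqP => [e|ne]; last by rewrite H //; lia.
  by rewrite e in d *; case: (F m v.-1 j) d.
have mskC : top_sign m (C i.+1) = F m.-1 v i.+1.
  rewrite /top_sign m0 andbT.
  case: (ltngtP m lo) mlo => // [lm|e] _.
    have lm1 : lo <= m.-1 by lia. have lm2 : m.-1 < hi by lia.
    move: Ct; rewrite /C /raise.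
    case: (profileP F0 v lo hi i.+1) => [[z H]|[a b c d [-> H]]].
      by rewrite z /= z (ltn_eqF m0) H.
    rewrite (gtn_eqF a) /= => Ct.
    case: eqP => [e|ne]; last by rewrite H //; lia.
    have -> : m.-1 = (profile F v lo hi i.+1).1 by lia.
    by case: (F _ v i.+1) d.
  have -> : (C i.+1).1 == m = false by move: (Cb i.+1); lia.
  by rewrite e col_lo.
split=> //.
  rewrite /strip_weight -/m mskC !mskA // /cell y0 /=.
  by case: (F m.-1 v i.+1); case: (F m v.-1 i); case: (F m v.-1 i.+1).
have lt j : (A j).1 <= m -> F m v.-1 j = S0 -> (A j).1 < m.
  move=> le z; rewrite ltn_neqAle le andbT; apply/eqP => e.
  move: (mskA j le); rewrite /top_sign e eqxx m0 /= z; by case: ifP.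
have eq j : (A j).1 <= m -> F m v.-1 j != S0 -> (A j).1 = m.
  by move=> le h; apply/eqP; rewrite eqn_leq le; apply: (profile_ge F0).
by split; [exact: lt|exact: lt|exact: eq|exact: eq].
Qed.

Lemma cluster_pt i : [\/ strip_weight (A i) (C i.+1) (A i.+1) <= wt i,
     [/\ (A i).1 < (C i.+1).1, (A i.+1).1 < (C i.+1).1 & gauge (A i) (A i.+1) <= wt i] |
     [/\ leading k lam lo v, 0 < top_pos F lo v & [/\ (C i.+1).1 = 0, (A i).1 <= lo, (A i.+1).1 <= lo, (A i).1 != (A i.+1).1 & 0 < wt i]]].
Proof.
set m := maxn (A i).1 (maxn (C i.+1).1 (A i.+1).1).
case: (posnP m) => [m0|m0].
  by constructor 1; rewrite /strip_weight -/m m0 /top_sign !andbF.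
have [mlo mhi y0 cE [la lt ea et]] := cluster_cell m0.
have mN : m < N by lia.
have w : weight_right v m i.+1 <= wt i.
  have := @nsum_ge N (fun u => ((lo <= u) && (u < hi)) * weight_right v u i.+1) m mN.
  by rewrite mlo mhi mul1n.
move: w; rewrite {1}/weight_right Hlst // Hnxt // -/(A i) -/(A i.+1) -/(C i.+1) -/m eqxx.
case t : (thrice m v i.+1).
  have [/la a /lt b] := HT t => w; constructor 2.
  by split=> //; rewrite /m in a b; lia.
case r : (reduced_right m v i.+1); last by rewrite -cE; constructor 1.
move: r => /and4P[mn Y _ X] w.
have ml : m = lo by move: (leading_sep mn) (Hlst mlo mhi) => /= ->.
constructor 3; rewrite -ml; split=> //.
have Cz : (C i.+1).1 = 0.
  have : (C i.+1).1 <= m by rewrite /m; lia.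
  rewrite /C /raise ml; case: (profileP F0 v lo hi i.+1) => [[z _]|[a b c d _]]; first by rewrite z eqxx z.
  by rewrite (gtn_eqF a) /=; lia.
split=> //; try by rewrite /m; lia.
move: X; case xa: (F m v.-1 i.+1.-1 == S0); case xb: (F m v.-1 i.+1 == S0) => //= _.
  by have := la (eqP xa); rewrite et ?xb //; lia.
by have := lt (eqP xb); rewrite ea ?xa //; lia.
Qed.

Lemma nsum_cluster : nsum N wt = interval_sum lo hi (fun u => nsum N (fun i => weight_right v u i.+1)).
Proof.
rewrite /wt /interval_sum nsum_swap; apply: nsum_eq => u _.
by rewrite /nsum big_distrr.
Qed.

Lemma cluster_gain : row_gauge N (profile F v.-1 lo hi) + 2 * leading k lam lo v
  <= interval_sum lo hi (fun u => nsum N (fun i => weight_right v u i.+1)) + row_gauge N (profile F v lo hi).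
Proof.
rewrite -nsum_cluster -(row_gauge_raise N (profile F v lo hi)) -/A -/C.
have A0 : (A 0).1 = 0 by apply: (profile_i0 F0).
have shz x : x.1 = 0 -> (raise x).1 = 0 by move=> z; rewrite /raise z eqxx z.
have C0 : (C 0).1 = 0 by apply: shz; apply: (profile_i0 F0).
have AN i : N <= i -> (A i).1 = 0 by move=> h; apply: (@profile_out k N F F0).
have CN i : N <= i -> (C i).1 = 0 by move=> h; apply: shz; apply: (@profile_out k N F F0).
case mn : (leading k lam lo v); last first.
  rewrite muln0 addn0; apply: strip_ge0 => //; try by [exact: AN|exact: CN].
  move=> i _; case: (cluster_pt i) => [h|h|[]]; [by left|by right|by rewrite mn].
have [lo0 v2 X P] := leading_dom F0 Hlam Hlow mn.
(* If column [lo] continues in row [v], all raised ranks exceed [lo], and cells at rank [lo] may be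
   reduced. If it ends, its point in row v - 1 starts the walks at level 0; [reduced_right] does not
   occur then. *)
rewrite muln1; apply: (@strip_gain A C N (if 0 < top_pos F lo v then lo else 0) wt A0 C0 AN CN).
- move=> i; rewrite /C /raise; case: (profileP F0 v lo hi i) => [[z _]|[a b c _ _]]; first by left; rewrite z eqxx z.
  by right; rewrite (gtn_eqF a) /=; case: ifP => _; lia.
- case: (posnP (top_pos F lo v)) => h /=.
    exists (top_pos F lo v.-1); rewrite ?eqxx /=.
    have : lo <= (A (top_pos F lo v.-1)).1 by apply: (profile_ge F0) => //; apply: top_pos_real.
    by move=> q; apply/orP; right; lia.
  exists (top_pos F lo v).
  have : lo <= (profile F v lo hi (top_pos F lo v)).1 by apply: (profile_ge F0) => //; apply: top_pos_real.
  by rewrite /C /raise => q; case: ifP => /=; lia.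
- move=> i _; case: (cluster_pt i) => [h|h|[_ h1 h2]]; [by constructor 1|by constructor 2|].
  by constructor 3; rewrite h1.
Qed.
End OneCluster.
End Clusters.

Lemma interval_sum_nsum N lo hi f : lo <= hi -> hi <= N -> interval_sum N lo hi f + nsum lo f = nsum hi f.
Proof.
move=> lh hN; rewrite /interval_sum.
elim: hi lh hN => [|h IH] lh hN.
  have -> : lo = 0 by lia.
  by rewrite !nsum0 nsum_zero.
move: lh; rewrite leq_eqVlt => /orP[/eqP e|lh].
  by rewrite nsum_zero ?e // => i _; case: leqP => //= a; case: ltnP => //; lia.
rewrite nsumS -IH; try lia.
have -> : nsum N (fun u => ((lo <= u) && (u < h.+1)) * f u)
   = nsum N (fun u => ((lo <= u) && (u < h)) * f u + (u == h) * f u).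
  apply: nsum_eq => u _; case: (ltngtP u h) => a; rewrite ?andbF ?andbT.
  - have -> : u < h.+1 by lia. by rewrite andbT; lia.
  - have -> : u < h.+1 = false by lia. by rewrite andbF; lia.
  - subst u; rewrite ltnS leqnn andbT; have -> : lo <= h by lia. lia.
by rewrite nsumD nsum_pick hN; lia.
Qed.

Lemma nsum_head lo hi f : lo < hi -> (forall s, lo < s -> s < hi -> f s = 0) ->
  nsum hi f = nsum lo f + f lo.
Proof.
elim: hi => // h IH; rewrite ltnS leq_eqVlt => /orP[/eqP -> _|lh H]; first by rewrite nsumS.
have Hh : f h = 0 by apply: H.
rewrite nsumS IH // ?Hh ?addn0 //.
by move=> s a b; apply: H => //; lia.
Qed.

(** * Right view: telescoping over the rows *)

Section Rows.
Variables (k N : nat) (lam : nat -> nat) (F : nat -> nat -> nat -> sgn).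
Variable thrice : nat -> nat -> nat -> bool.
Hypothesis F0 : forall u v i, F u v i != S0 -> [/\ 0 < u, 0 < i, i < v & u + v <= k + 3].
Hypothesis Hlam : forall w, 3 <= w <= k + 3 -> exists i, F (lam w) (w - lam w) i != S0.
Hypothesis Hlow : forall w u v i, 3 <= w <= k + 3 -> u < lam w -> w <= u + v -> F u v i = S0.
Hypothesis HT : forall u v i, thrice u v i -> F u v.-1 i.-1 = S0 /\ F u v.-1 i = S0.
Hypothesis kN : k + 10 <= N.

Let sp := separator k lam.
Let W v u := nsum N (fun i => weight_right k N lam F thrice v u i.+1).
Let mn u v := leading k lam u v : nat.

Fixpoint closed_gauge v r n := if n is m.+1 then
   closed_gauge v r m + (if sp v m then row_gauge N (profile F r (cluster_start k lam v m) m) else 0) else 0.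

(** The gauge of row [r] cut at the separators of row [v]. Two indices are needed because the strip
    below row [v] compares rows v - 1 and v with the same cuts, and the cuts change between
    strips. *)
Definition row_potential v r := closed_gauge v r N + row_gauge N (profile F r (cluster_start k lam v N) N).

Lemma one_cluster v n lo : 0 < n -> n <= N -> n = N \/ sp v n -> lo = cluster_start k lam v n ->
  row_gauge N (profile F v.-1 lo n) + 2 * nsum n (fun u => mn u v) + nsum lo (W v)
  <= nsum n (W v) + 2 * nsum lo (fun u => mn u v) + row_gauge N (profile F v lo n).
Proof.
move=> n0 nN sn loE.
have lon : lo < n by have := cluster_start_le k lam v n; lia.
have gap s : lo < s -> s < n -> sp v s = false by rewrite loE; apply: cluster_start_gap.
have sl : lo = 0 \/ sp v lo by rewrite loE; apply: cluster_start_sep.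
have := @cluster_gain k N lam F thrice F0 Hlam Hlow HT kN v lo n lon nN sl sn.
have Hl u : lo <= u -> u < n -> cluster_start k lam v u.+1 = lo by rewrite loE; apply: cluster_start_eq.
have Hn u : lo <= u -> u < n -> cluster_end k N lam v u = n.
  by move=> a b; apply: cluster_end_eq => // s c d; apply: gap => //; lia.
move=> /(_ Hl Hn).
have := @interval_sum_nsum N lo n (W v) (ltnW lon) nN.
have : nsum n (fun u => mn u v) = nsum lo (fun u => mn u v) + mn lo v.
  apply: nsum_head lon _ => s a b; rewrite /mn; case m : (leading k lam s v) => //.
  by have := leading_sep F0 Hlam Hlow m; rewrite -/(sp v s) gap.
rewrite -/(mn lo v) /W; lia.
Qed.

Lemma row_gain v : row_potential v v.-1 + 2 * nsum N (fun u => mn u v) <= nsum N (W v) + row_potential v v.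
Proof.
have N0 : 0 < N by lia.
suff H n : n <= N -> closed_gauge v v.-1 n + 2 * nsum (cluster_start k lam v n) (fun u => mn u v)
   <= nsum (cluster_start k lam v n) (W v) + closed_gauge v v n.
  have := H N (leqnn N); have := @one_cluster v N _ N0 (leqnn N) (or_introl erefl) erefl.
  rewrite /row_potential /=; lia.
elim: n => [|n IH] nN; first by rewrite /= !nsum0.
have := IH (ltnW nN); rewrite /=; fold sp; case: ifP => sn; last by rewrite !addn0.
have := @one_cluster v n _ (separator_gt0 F0 Hlam sn) (ltnW nN) (or_intror sn) erefl.
rewrite /=; lia.
Qed.

Variable ch : nat -> nat -> nat.
Hypothesis Hch : forall l v lo hi, new_separator k lam l v -> lo < l -> l < hi -> hi <= N ->
  row_gauge N (profile F v lo hi) + ch l v <= row_gauge N (profile F v lo l) + row_gauge N (profile F v l hi).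

Definition split_surplus v := nsum N (fun l => new_separator k lam l v * ch l v).

Lemma separatorS v l : sp v.+1 l = sp v l || new_separator k lam l v.
Proof. by rewrite /sp /separator -[in iota 0 v.+1](addn1 v) iotaD has_cat /= orbF orbA. Qed.

(** By monotonicity [lam] takes the value [l] on an interval of levels, so it can jump to [l] only
    once. *)
Lemma new_separator_fresh v l : new_separator k lam l v -> sp v l = false.
Proof.
move=> nl; have [l0 v2 a e] := new_separator_dom F0 Hlam nl.
apply/negP => /(separatorP _ _ _ _)[l1|[v' [vv nl']]].
  have j : jump k lam (l + v) by move: nl => /andP[].
  have := jump_lt F0 Hlam Hlow j; rewrite e.
  have [b _ _] := lam_dom F0 Hlam (w := (l + v).-1) ltac:(lia); lia.
have [_ _ a' e'] := new_separator_dom F0 Hlam nl'.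
have j : jump k lam (l + v) by move: nl => /andP[].
have := jump_lt F0 Hlam Hlow j; rewrite e.
have := @lam_mono k lam F F0 Hlam Hlow (l + v') (l + v).-1; rewrite e'; lia.
Qed.

Lemma split_gain v : row_potential v v + split_surplus v <= row_potential v.+1 v.
Proof.
(* [h] is the right end of the cluster that is still open at [n]. *)
suff H n h : n <= h -> h <= N -> closed_gauge v v n + row_gauge N (profile F v (cluster_start k lam v n) h) +
   nsum n (fun l => new_separator k lam l v * ch l v)
   <= closed_gauge v.+1 v n + row_gauge N (profile F v (cluster_start k lam v.+1 n) h).
  by have := H N N (leqnn N) (leqnn N); rewrite /row_potential /split_surplus; lia.
elim: n h => [|n IH] h nh hN; first by rewrite /= nsum0 addn0.
rewrite nsumS /= -/(sp v n) -/(sp v.+1 n) separatorS.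
case s : (sp v n) => /=.
  have -> : new_separator k lam n v = false.
    by apply/negP => /new_separator_fresh; rewrite s.
  by rewrite mul0n addn0; have := IH n (leqnn n); lia.
case ns : (new_separator k lam n v) => /=; last first.
  by rewrite mul0n !addn0; apply: IH => //; lia.
have n0 : 0 < n by have [] := new_separator_dom F0 Hlam ns.
have lo : cluster_start k lam v.+1 n < n by have := cluster_start_le k lam v.+1 n; lia.
have := @Hch n v (cluster_start k lam v.+1 n) h ns lo nh hN.
by have := IH h; lia.
Qed.

(** The sum can start at row 3, as leading pairs need v > 2, and it ends at an empty row, where the
    potential vanishes. *)
Lemma right_total :
  2 * nsum N (fun v => nsum N (fun u => mn u v)) + nsum N split_surplus
  <= nsum N (fun v => nsum N (W v)).
Proof.
have mn0 v : v < 3 -> nsum N (fun u => mn u v) = 0.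
  move=> h; apply: nsum_zero => u _; rewrite /mn; case m : (leading k lam u v) => //.
  by have [] := leading_dom F0 Hlam Hlow m; lia.
have ch0 v : v < 2 -> split_surplus v = 0.
  move=> h; apply: nsum_zero => u _; case m : (new_separator k lam u v) => //.
  by have [] := new_separator_dom F0 Hlam m; lia.
suff H n : n + 3 <= N -> 2 * nsum (n + 3) (fun v => nsum N (fun u => mn u v)) + nsum (n + 3) split_surplus
  <= nsum (n + 3) (fun v => nsum N (W v)) + row_potential (n + 3) (n + 2).
  have := H (N - 3); have -> : N - 3 + 3 = N by lia.
  suff -> : row_potential N (N - 3 + 2) = 0 by rewrite leqnn addn0; apply.
  have G0 lo hi : row_gauge N (profile F (N - 3 + 2) lo hi) = 0.
    apply: row_gauge_ph => i; case: (profileP F0 (N - 3 + 2) lo hi i) => [[]//|[_ _ _ /F0[]]]; lia.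
  suff C0 n : closed_gauge N (N - 3 + 2) n = 0 by rewrite /row_potential G0 C0.
  by elim: n => //= n ->; rewrite G0; case: ifP.
elim: n => [|n IH] nN.
  rewrite !add0n !nsumS !nsum0 !mn0 // (ch0 0) // (ch0 1) //.
  by have := split_gain 2; lia.
have := IH ltac:(lia).
have -> : n.+1 + 3 = (n + 3).+1 by lia. have -> : n.+1 + 2 = n + 3 by lia.
rewrite !nsumS; have := row_gain (n + 3); have := split_gain (n + 3).
have -> : (n + 3).-1 = n + 2 by lia.
lia.
Qed.
End Rows.

(** * Single points seen from three sides *)

Lemma nsum_le1 N (P : nat -> bool) : (forall u u', P u -> P u' -> u = u') -> nsum N (fun u => P u) <= 1.
Proof.
move=> H; elim: N => [|N IH]; first by rewrite nsum0.
rewrite nsumS; case PN : (P N); last by rewrite addn0.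
rewrite nsum_zero // => i iN; case Pi : (P i) => //.
by have := H _ _ Pi PN; lia.
Qed.

Lemma nsum_inj N (P : nat -> bool) (h f : nat -> nat) :
  (forall u, P u -> h u < N) -> (forall u u', P u -> P u' -> h u = h u' -> u = u') ->
  nsum N (fun u => P u * f (h u)) <= nsum N f.
Proof.
move=> hN inj.
rewrite (_ : nsum N _ = nsum N (fun u => nsum N (fun t => (P u && (h u == t)) * f t))).
  rewrite nsum_swap; apply: nsum_le => t _.
  have -> : nsum N (fun u => (P u && (h u == t)) * f t) = nsum N (fun u => P u && (h u == t)) * f t.
    by rewrite /nsum big_distrl.
  rewrite -{2}(mul1n (f t)) leq_mul2r; apply/orP; right; apply: nsum_le1.
  by move=> u u' /andP[p /eqP e] /andP[p' /eqP e']; apply: inj => //; rewrite e.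
apply: nsum_eq => u _; case p : (P u) => /=; last by rewrite nsum_zero.
rewrite (@nsum_eq _ _ (fun t => (t == h u) * f t)); last by move=> t _; rewrite eq_sym.
by rewrite nsum_pick hN.
Qed.

Section Walk.
Variables (k : nat) (F : nat -> nat -> nat -> sgn).
Hypothesis F0 : forall u v i, F u v i != S0 -> [/\ 0 < u, 0 < i, i < v & u + v <= k + 3].

Definition events t v : nat := event_cell F t v + event_up F t v.

(* From a cell of thrice, follow row v to the left while the two views along
   e2 - e3 see points of equal rank; the walk stops at an event, or at a tie. *)
Fixpoint walk_end v t := if t is s.+1 then
  if [&& top_pos F t v.-1 == 0, top_pos F s v == top_pos F t v & 0 < top_pos F s v] then walk_end v s else t else 0.

(** The topmost points of rows v - 1 and v have the same third coordinate, that is the same rank. *)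
Definition tie_at v t := (0 < top_pos F t v.-1) && ((top_pos F t v.-1).+1 == top_pos F t v).

Lemma walk_end_spec v t : 0 < top_pos F t v ->
  [/\ 0 < walk_end v t, walk_end v t <= t,
     forall s, walk_end v t <= s -> s <= t -> top_pos F s v = top_pos F t v,
     forall s, walk_end v t < s -> s <= t -> top_pos F s v.-1 = 0 &
     (top_pos F (walk_end v t) v.-1 == 0) ==> (top_pos F (walk_end v t).-1 v != top_pos F t v)].
Proof.
elim: t => [|t IH] p; first by have [] := top_pos_dom F0 p.
rewrite /=; case: ifP => [/and3P[/eqP a /eqP b c]|n].
  have [h1 h2 h3 h4 h5] := IH c; split=> //.
  - by lia.
  - by move=> s s1; rewrite leq_eqVlt => /orP[/eqP -> //|s2]; rewrite -b; apply: h3.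
  - by move=> s s1; rewrite leq_eqVlt => /orP[/eqP -> //|s2]; apply: h4.
  - by rewrite -b.
split=> //.
- by move=> s a b; have -> : s = t.+1 by lia.
- by move=> s a b; lia.
apply/implyP => /= z; apply: contraFN n => /eqP e.
by rewrite z e eqxx p.
Qed.

Lemma walk_end_event v t : 0 < top_pos F t v -> top_pos F t.+1 v.-1 = 0 ->
  1 <= events (walk_end v t) v + tie_at v (walk_end v t).
Proof.
move=> p z; have [h1 h2 h3 h4 h5] := walk_end_spec p.
have e := h3 _ (leqnn _) h2.
have z' : top_pos F (walk_end v t).+1 v.-1 = 0.
  by case: (ltngtP (walk_end v t) t) h2 => // [h _|-> //]; apply: h4.
rewrite /events /event_cell /event_up /tie_at e p z' eqxx /=.
case: (posnP (top_pos F (walk_end v t) v.-1)) h5 => [_ /= ->|q _] //=.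
by case: eqP.
Qed.
End Walk.

(** The exchange of the second and third coordinates, which turns one view along e_2 - e_3 into the
    opposite one. *)
Definition mirror (F : nat -> nat -> nat -> sgn) u v i := F u v (v - i).

Section RowWalk.
Variables (k N : nat) (lam : nat -> nat) (F : nat -> nat -> nat -> sgn).
Hypothesis F0 : forall u v i, F u v i != S0 -> [/\ 0 < u, 0 < i, i < v & u + v <= k + 3].
Hypothesis Hlam : forall w, 3 <= w <= k + 3 -> exists i, F (lam w) (w - lam w) i != S0.
Hypothesis Hlow : forall w u v i, 3 <= w <= k + 3 -> u < lam w -> w <= u + v -> F u v i = S0.
Let M := mirror F.

Lemma mirror_F0 u v i : M u v i != S0 -> [/\ 0 < u, 0 < i, i < v & u + v <= k + 3].
Proof. by move=> /F0[]; split=> //; lia. Qed.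

Lemma mirror_lam w : 3 <= w <= k + 3 -> exists i, M (lam w) (w - lam w) i != S0.
Proof.
move=> /Hlam[i Fi]; exists (w - lam w - i); rewrite /M /mirror.
have [_ _ h _] := F0 Fi; have -> // : w - lam w - (w - lam w - i) = i by lia.
Qed.

Lemma mirror_low w u v i : 3 <= w <= k + 3 -> u < lam w -> w <= u + v -> M u v i = S0.
Proof. by move=> a b c; apply: Hlow a b c. Qed.

Lemma mirror_real u v j : F u v j != S0 -> M u v (v - j) != S0.
Proof.
by move=> h; have [_ _ a _] := F0 h; rewrite /M /mirror; have -> : v - (v - j) = j by lia.
Qed.

Lemma mirror_mx0 u v : (top_pos M u v == 0) = (top_pos F u v == 0).
Proof.
case: (posnP (top_pos F u v)) => [z|p].
  rewrite top_pos_eq0 // => j; rewrite /M /mirror.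
  case: (posnP (v - j)) => [->|h]; last by apply: (top_pos_out F0); rewrite z.
  by case E : (F u v 0) => //; have [] := @F0 u v 0; rewrite ?E.
by have := top_pos_gt0 mirror_F0 (mirror_real (top_pos_real p)); lia.
Qed.

Definition thrice u v i := [&& F u.-1 v i != S0, F u v i == S0, F u v.-1 i.-1 == S0, F u v.-1 i == S0,
   visible_top F u v i & visible_top M u v (v - i)].

(** Visibility from both ends squeezes the fibres: those over (u, v) and (u, v - 1) are left with no
    position, and the one over (u - 1, v) with the position [i] alone. *)
Lemma thrice_facts u v i : thrice u v i ->
  [/\ top_pos F u v = 0, top_pos F u v.-1 = 0, top_pos F u.-1 v = i & top_pos M u.-1 v = v - i].
Proof.
move=> /and5P[p /eqP y _ _ /andP[/and3P[a b c] /and3P[a' b' c']]].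
split.
- apply/eqP; apply/negPn/negP; rewrite -lt0n => h.
  have := top_pos_ge mirror_F0 (mirror_real (top_pos_real h)).
  have [_ h1 _] := top_pos_dom F0 h.
  move=> h2; move: (top_pos_real h); have -> : top_pos F u v = i by lia.
  by rewrite y.
- apply/eqP; apply/negPn/negP; rewrite -lt0n => h.
  have := top_pos_ge mirror_F0 (mirror_real (top_pos_real h)).
  by have [_ h1 _] := top_pos_dom F0 h; lia.
- by apply/eqP; rewrite eqn_leq b (top_pos_ge F0).
- by apply/eqP; rewrite eqn_leq b' (top_pos_ge mirror_F0) // mirror_real.
Qed.

Lemma thrice_sing u v i : thrice u v i -> F u v.-1 i.-1 = S0 /\ F u v.-1 i = S0.
Proof. by move=> /and5P[_ _ /eqP a /eqP b _]. Qed.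

Hypothesis kN : k + 10 <= N.

Definition rowA v u := profile F v.-1 (cluster_start k lam v u.+1) (cluster_end k N lam v u).
Definition rowC v u j := raise (profile F v (cluster_start k lam v u.+1) (cluster_end k N lam v u) j).

Definition thrice_gauge v u i :=
  if (u == maxn (rowA v u i.-1).1 (maxn (rowC v u i).1 (rowA v u i).1)) && thrice u v i
  then gauge (rowA v u i.-1) (rowA v u i) else 0.

Lemma gauge_le2 x y : gauge x y <= 2.
Proof. by rewrite /gauge; case: ifP => // _; case: ifP. Qed.

Lemma cluster_end_gt v u : u < cluster_end k N lam v u.
Proof. by rewrite /cluster_end; lia. Qed.

(** Each walk ends in an event, worth one unit, or in a tie. Two ties are impossible, and a single
    tie forces a break in row v - 1 behind the cell, which lowers the gauge from at most 2 to 1. *)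
Lemma thrice_gauge_le v u i : thrice_gauge v u i <= events F (walk_end F v u.-1) v + events M (walk_end M v u.-1) v.
Proof.
rewrite /thrice_gauge; case: ifP => // /andP[/eqP um t].
have [z zx mF mM] := thrice_facts t.
have /and5P[Fp _ _ _ _] := t.
have [u1 i0 iv uv] := F0 Fp.
have pF : 0 < top_pos F u.-1 v by rewrite mF.
have pM : 0 < top_pos M u.-1 v by rewrite mM; lia.
have zF : top_pos F u.-1.+1 v.-1 = 0 by have -> : u.-1.+1 = u by lia.
have zM : top_pos M u.-1.+1 v.-1 = 0.
  by apply/eqP; rewrite mirror_mx0 zF.
have eF := walk_end_event F0 pF zF. have eM := walk_end_event mirror_F0 pM zM.
have [f1 f2 f3 f4 _] := walk_end_spec F0 pF.
have [m1 m2 m3 m4 _] := walk_end_spec mirror_F0 pM.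
set A := rowA v u in um *.
set lo := cluster_start k lam v u.+1.
have lou : lo <= u by have := cluster_start_le k lam v u.+1; rewrite -/lo.
have A1 : (A i.-1).1 <= u by lia.
have A2 : (A i).1 <= u by lia.
(* Along the walk row v - 1 is empty to the right of [t'], and row [v] is occupied, so no separator
   cuts between [t'] and [u]. The points of column [t'] in row v - 1 are therefore seen from the
   right. *)
have rank t' j : t' < u -> (forall s, t' <= s -> s < u -> 0 < top_pos F s v) ->
    (forall s, t' < s -> s <= u -> top_pos F s v.-1 = 0) -> (A j).1 <= u -> 0 < t' ->
    ((A j).1 == t') = (F t' v.-1 j != S0).
  move=> tu Yp Xz Aj t0.
  have lot : lo <= t'.
    rewrite leqNgt; apply/negP => h.
    have s : separator k lam v lo by case: (cluster_start_sep k lam v u.+1) => //; rewrite -/lo; lia.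
    have := Yp lo.-1 ltac:(lia) ltac:(lia).
    have -> // : top_pos F lo.-1 v = 0 by apply: top_pos_eq0 => q; exact: (separator_empty F0 Hlam Hlow q s (leqnn v)).
  have le : (A j).1 <= t'.
    rewrite leqNgt; apply/negP => h.
    case: (profileP F0 v.-1 lo (cluster_end k N lam v u) j) => [[e _]|[_ _ _ r _]]; first by rewrite /A /rowA e in h.
    by have := top_pos_gt0 F0 r; rewrite -/(A j) Xz.
  apply/eqP/idP => [e|r].
    case: (profileP F0 v.-1 lo (cluster_end k N lam v u) j) => [[e' _]|[_ _ _ r _]].
      by move: e; rewrite /A /rowA e'; lia.
    by rewrite -e.
  apply/eqP; rewrite eqn_leq le; apply: (profile_ge F0) => //.
  by have := cluster_end_gt v u; lia.
have u1u : u.-1 < u by lia.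
case tF : (tie_at F v (walk_end F v u.-1)); case tM : (tie_at M v (walk_end M v u.-1)).
(* Both walks would stop in one column, whose points in row v - 1 would have highest position i - 1
   and lowest position i. *)
- move: tF tM => /andP[a /eqP a'] /andP[b /eqP b'].
  have ab : walk_end F v u.-1 = walk_end M v u.-1.
    case: (ltngtP (walk_end F v u.-1) (walk_end M v u.-1)) => // h.
      by have := f4 _ h m2; have := mirror_mx0 (walk_end M v u.-1) v.-1; lia.
    by have := m4 _ h f2; have := mirror_mx0 (walk_end F v u.-1) v.-1; lia.
  have := top_pos_ge mirror_F0 (mirror_real (top_pos_real a)).
  have := f3 _ (leqnn _) f2; have := m3 _ (leqnn _) m2.
  by have [_ h _] := top_pos_dom F0 a; rewrite -ab in b b' *; lia.
(* The tie puts the top of column [t'] in row v - 1 at position i - 1: [A i.-1] has rank [t'] and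
   [A i] has not. *)
- move: tF => /andP[a /eqP a']; set t' := walk_end F v u.-1 in a a' f1 f2 f3 f4 eF *.
  have R j : (A j).1 <= u -> ((A j).1 == t') = (F t' v.-1 j != S0).
    move=> h; apply: rank => //; first by lia.
      by move=> s s1 s2; rewrite f3 //; lia.
    move=> s s1; rewrite leq_eqVlt => /orP[/eqP -> //|s2]; apply: f4 => //; lia.
  have e : top_pos F t' v = i by rewrite f3.
  have r1 : (A i.-1).1 == t'.
    have ie : i.-1 = top_pos F t' v.-1 by lia.
    by rewrite R // ie; apply: top_pos_real.
  have r2 : (A i).1 == t' = false.
    by rewrite R //; apply/negbF; apply/eqP; apply: (top_pos_out F0); lia.
  have -> : gauge (A i.-1) (A i) = 1 by rewrite /gauge (eqP r1) eq_sym r2.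
  by rewrite tM in eM; lia.
- move: tM => /andP[a /eqP a']; set t' := walk_end M v u.-1 in a a' m1 m2 m3 m4 eM *.
  have R j : (A j).1 <= u -> ((A j).1 == t') = (F t' v.-1 j != S0).
    move=> h; apply: rank => //; first by lia.
      move=> s s1 s2; have := m3 s s1 ltac:(lia); have := mirror_mx0 s v; lia.
    move=> s s1; rewrite leq_eqVlt => /orP[/eqP -> //|s2].
    have := m4 s s1 ltac:(lia); have := mirror_mx0 s v.-1; lia.
  have e : top_pos M t' v = v - i by rewrite m3.
  have [_ h _] := top_pos_dom mirror_F0 a.
  have r1 : (A i).1 == t'.
    rewrite R //; have := top_pos_real a; rewrite {1}/M /mirror.
    by have -> : v.-1 - top_pos M t' v.-1 = i by lia.
  have r2 : (A i.-1).1 == t' = false.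
    rewrite R //; apply/negbTE/negP => q; have := top_pos_ge mirror_F0 (mirror_real q); lia.
  have -> : gauge (A i.-1) (A i) = 1 by rewrite /gauge (eqP r1) r2.
  by rewrite tF in eF; lia.
- by rewrite tF tM in eF eM *; have := gauge_le2 (A i.-1) (A i); lia.
Qed.

(** No event is charged twice in the same view: a walk crosses only columns occupied in row [v],
    while the column [u] of a cell of [thrice] is empty there and stops every walk from further
    right. *)
Lemma thrice_gauge_row v : nsum N (fun u => nsum N (fun i => thrice_gauge v u i.+1))
  <= nsum N (fun t => events F t v) + nsum N (fun t => events M t v).
Proof.
pose P u := thrice u v (top_pos F u.-1 v).
have PF u : P u -> [/\ 0 < u, 0 < top_pos F u.-1 v, top_pos F u v = 0 & u <= k + 3].
  move=> p; have [a b c d] := thrice_facts p; move: p => /and5P[h _ _ _ _].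
  by have [e f g q] := F0 h; split=> //; lia.
have PM u : P u -> 0 < top_pos M u.-1 v /\ top_pos M u v = 0.
  move=> /PF[a b c _]; have := mirror_mx0 u.-1 v; have := mirror_mx0 u v; lia.
apply: leq_trans (_ : nsum N (fun u => P u * events F (walk_end F v u.-1) v + P u * events M (walk_end M v u.-1) v) <= _).
  apply: nsum_le => u uN.
  apply: leq_trans (_ : nsum N (fun i => (i == (top_pos F u.-1 v).-1) * thrice_gauge v u i.+1) <= _).
    apply: nsum_le => i _; case: eqP => [_|ne]; first by rewrite mul1n.
    rewrite {1}/thrice_gauge; case: ifP => // /andP[_ t].
    by have [_ _ e _] := thrice_facts t; case: ne; rewrite e.
  rewrite (nsum_pick _ _ (fun i => thrice_gauge v u i.+1)).
  case p : (P u).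
    have [a b c d] := PF _ p; have -> : (top_pos F u.-1 v).-1.+1 = top_pos F u.-1 v by lia.
    have := thrice_gauge_le v u (top_pos F u.-1 v); rewrite !mul1n.
    by case: (top_pos F u.-1 v <= N); rewrite ?mul1n ?mul0n.
  case: (posnP (top_pos F u.-1 v)) => [z|q].
    rewrite /thrice_gauge (_ : thrice u v _ = false) ?andbF ?muln0 //.
    by apply/negP => /thrice_facts[_ _ e _]; rewrite z in e.
  have -> : (top_pos F u.-1 v).-1.+1 = top_pos F u.-1 v by lia.
  have p' : thrice u v (top_pos F u.-1 v) = false by exact: p.
  by rewrite /thrice_gauge p' andbF muln0.
rewrite nsumD; apply: leq_add.
- apply: (@nsum_inj N P (fun u => walk_end F v u.-1) (fun t => events F t v)).
    by move=> u /PF[a b c d]; have [_ h _ _ _] := walk_end_spec F0 b; lia.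
  suff H u u' : P u -> P u' -> u < u' -> walk_end F v u.-1 = walk_end F v u'.-1 -> False.
    move=> u u' p p' e; case: (ltngtP u u') => // h; first by case: (H _ _ p p' h e).
    by case: (H _ _ p' p h (esym e)).
  move=> /PF[a b c d] /PF[a' b' c' d'] lt e.
  have [_ h _ _ _] := walk_end_spec F0 b; have [_ _ h' _ _] := walk_end_spec F0 b'.
  by have := h' u ltac:(lia) ltac:(lia); lia.
- apply: (@nsum_inj N P (fun u => walk_end M v u.-1) (fun t => events M t v)).
    by move=> u p; have [a b c d] := PF _ p; have [b' _] := PM _ p;
       have [_ h _ _ _] := walk_end_spec mirror_F0 b'; lia.
  suff H u u' : P u -> P u' -> u < u' -> walk_end M v u.-1 = walk_end M v u'.-1 -> False.
    move=> u u' p p' e; case: (ltngtP u u') => // h; first by case: (H _ _ p p' h e).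
    by case: (H _ _ p' p h (esym e)).
  move=> p p' lt e; have [a _ _ _] := PF _ p; have [b c] := PM _ p; have [b' c'] := PM _ p'.
  have [_ h _ _ _] := walk_end_spec mirror_F0 b; have [_ _ h' _ _] := walk_end_spec mirror_F0 b'.
  by have := h' u ltac:(lia) ltac:(lia); lia.
Qed.
End RowWalk.

Lemma nsum_mulr N c f : nsum N (fun i => c * f i) = c * nsum N f.
Proof. by rewrite /nsum big_distrr. Qed.

Lemma nsum_rev N v f : v <= N -> (forall i, v <= i -> f i = 0) -> f 0 = 0 ->
  nsum N f = nsum N (fun i => f (v - i.+1)).
Proof.
move=> vN fz f0.
have cut g : (forall i, v <= i -> g i = 0) -> nsum N g = nsum v g.
  move=> gz; elim: N vN => [|n IH]; first by rewrite leqn0 => /eqP ->.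
  rewrite leq_eqVlt => /orP[/eqP <- //|vn]; rewrite nsumS IH // gz ?addn0 //; lia.
rewrite (cut _ fz) (cut (fun i => f (v - i.+1))); last first.
  by move=> i vi; have -> : v - i.+1 = 0 by lia.
rewrite /nsum (reindex_inj rev_ord_inj) /=; by apply: eq_bigr.
Qed.

(** * Adding up the views *)

Section Total.
Variables (k N : nat) (lam : nat -> nat) (F : nat -> nat -> nat -> sgn).
Hypothesis F0 : forall u v i, F u v i != S0 -> [/\ 0 < u, 0 < i, i < v & u + v <= k + 3].
Hypothesis Hlam : forall w, 3 <= w <= k + 3 -> exists i, F (lam w) (w - lam w) i != S0.
Hypothesis Hlow : forall w u v i, 3 <= w <= k + 3 -> u < lam w -> w <= u + v -> F u v i = S0.
Hypothesis kN : k + 10 <= N.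

Let M := mirror F.
Let M0 := mirror_F0 F0.
Let Mlam := mirror_lam F0 Hlam.
Let Mlow := mirror_low Hlow.

Definition inner u v := (0 < v) && (4 <= u + v <= k + 4).

Definition node_at u v i := isnode (F u v i) (F u.-1 v i) (F u v.-1 i.-1) (F u v.-1 i).

Definition box (f : nat -> nat -> nat) := nsum N (fun u => nsum N (fun v => inner u v * f u v)).

Lemma diag_box f : (forall u, f u 0 = 0) ->
  nsum k.+1 (fun j => nsum N (fun u => f u (j + 4 - u))) = box f.
Proof.
move=> f0; rewrite /box -(@diag_sum k N (fun u v => inner u v * f u v)) //.
  apply: nsum_eq => j jk; apply: nsum_eq => u _; rewrite /inner.
  case: (posnP (j + 4 - u)) => [->|p]; first by rewrite f0 muln0.
  have -> : 4 <= u + (j + 4 - u) <= k + 4 by lia. by rewrite mul1n.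
by move=> u v; rewrite /inner; case: (posnP v) => //= v0; case: andP; lia.
Qed.

Lemma box_le f g : (forall u v, u < N -> v < N -> inner u v -> f u v <= g u v) -> box f <= box g.
Proof.
move=> H; apply: nsum_le => u uN; apply: nsum_le => v vN.
by case i : (inner u v) => //; rewrite !mul1n; apply: H.
Qed.

Lemma boxD f g : box (fun u v => f u v + g u v) = box f + box g.
Proof.
rewrite /box -nsumD; apply: nsum_eq => u _; rewrite -nsumD; apply: nsum_eq => v _; exact: mulnDr.
Qed.

Lemma box_mul c f : box (fun u v => c * f u v) = c * box f.
Proof.
rewrite /box -nsum_mulr; apply: nsum_eq => u _; rewrite -nsum_mulr; apply: nsum_eq => v _; lia.
Qed.

Lemma face_weight_zero a b c d : a = S0 -> b = S0 -> c = S0 -> d = S0 -> face_weight a b c d = 0.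
Proof. by move=> -> -> -> ->. Qed.

Section AnyF.
Variable G : nat -> nat -> nat -> sgn.
Hypothesis G0 : forall u v i, G u v i != S0 -> [/\ 0 < u, 0 < i, i < v & u + v <= k + 3].

Lemma outside_S0 u v i : [|| u == 0, i == 0, v <= i | k + 3 < u + v] -> G u v i = S0.
Proof. by move=> h; apply/eqP; apply/negPn/negP => /G0[]; move: h; lia. Qed.

Lemma weight_top_le u v i : weight_top k lam G u v i <= cell G u v i.
Proof.
rewrite /weight_top; case: ifP => // _; case: ifP => // /and5P[_ /eqP a /eqP b c /andP[/eqP d _]].
by rewrite /cell a b d; case: (G u v.-1 i.-1) c.
Qed.

Lemma weight_top_dead u v i : [|| u == 0, v == 0, i == 0, v <= i | k + 4 < u + v] -> weight_top k lam G u v i = 0.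
Proof.
move=> h; case i0 : (i == 0); first by rewrite /weight_top /visible_top (eqP i0) ltn0 !andbF.
apply/eqP; rewrite -leqn0; apply: leq_trans (weight_top_le _ _ _) _.
by rewrite /cell face_weight_zero //; apply: outside_S0; lia.
Qed.

Lemma weight_top_box (f : nat -> nat -> nat) :
  (forall u v, inner u v -> u < N -> nsum N (weight_top k lam G u v) <= f u v) ->
  nsum k.+1 (fun j => nsum N (fun t => nsum N (weight_top k lam G t.+1 (j + 4 - t.+1)))) <= box f.
Proof.
move=> H; apply: leq_trans (_ : box (fun u v => nsum N (weight_top k lam G u v)) <= _).
  rewrite -diag_box; last by move=> u; apply: nsum_zero => i _; apply: weight_top_dead; rewrite eqxx orbT.
  apply: nsum_le => j _.
  have := sum_shift (fun u => nsum N (weight_top k lam G u (j + 4 - u))) N.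
  rewrite (@nsum_zero N (weight_top k lam G N _)); last by move=> i _; apply: weight_top_dead; lia.
  rewrite /=; lia.
by apply: box_le => u v uN vN i; apply: H.
Qed.
End AnyF.

Lemma plus_bound : 2 * (k + 2) + nsum k.+1 (fun j => nsum N (fun t => events F t (j + 4 - t)))
  <= box (fun u v => nsum N (fun i => weight_top k lam F u v i.+1)).
Proof.
apply: leq_trans (weight_top_total F0 Hlam Hlow kN) _; apply: (weight_top_box F0) => u v _ _.
have := sum_shift (weight_top k lam F u v) N; rewrite (@weight_top_dead F F0 u v 0) ?eqxx ?orbT //; lia.
Qed.

Lemma minus_bound : 2 * (k + 2) + nsum k.+1 (fun j => nsum N (fun t => events M t (j + 4 - t)))
  <= box (fun u v => nsum N (fun i => weight_top k lam M u v (v - i.+1))).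
Proof.
apply: leq_trans (weight_top_total M0 Mlam Mlow kN) _; apply: (weight_top_box M0) => u v iv uN.
rewrite (@nsum_rev N v) //; first by move: iv; rewrite /inner; lia.
  by move=> i vi; apply: (weight_top_dead M0); rewrite vi !orbT.
by apply: (weight_top_dead M0); rewrite eqxx !orbT.
Qed.

Lemma left_bound : 2 * (k + 2) + 2 * nsum k.+1 (fun j => jump k lam (j + 4))
  <= box (fun u v => nsum N (fun i => weight_left k lam F u v i.+1)).
Proof.
rewrite -(@diag_box (fun u v => nsum N (fun i => weight_left k lam F u v i.+1))).
  exact: (weight_left_total kN F0 Hlam Hlow).
move=> u; apply: nsum_zero => i _; rewrite /weight_left; case: ifP => // /(leading_dom F0 Hlam Hlow)[]; lia.
Qed.

Definition ties w := (tied lam F w : nat) + tied lam M w.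

(** The cut positions are the highest and the lowest point of the new leading column, one for each
    view along e_2 - e_3. *)
Lemma ties_split l v lo hi : new_separator k lam l v -> lo < l -> l < hi -> hi <= N ->
  row_gauge N (profile F v lo hi) + ties (l + v) <= row_gauge N (profile F v lo l) + row_gauge N (profile F v l hi).
Proof.
move=> ns lol lhi _; have [l0 v2 a e] := new_separator_dom F0 Hlam ns.
have [_ _ c] := lam_dom F0 Hlam (w := l + v) ltac:(lia).
rewrite e addKn in c.
have cM : 0 < top_pos M l v by have := mirror_mx0 F0 l v; rewrite -/M; lia.
have [_ c1 _] := top_pos_dom M0 cM.
apply: (@profile_cut_gain k N F F0 v lo l hi (top_pos F l v) (v - top_pos M l v)) => //.
- rewrite /tied e addKn => /eqP t; split; first exact: top_pos_real.
    by rewrite -t; apply: top_pos_real; rewrite t.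
  by apply: (top_pos_out F0); rewrite t.
- rewrite /tied e addKn => /eqP t; split; first exact: (top_pos_real cM).
    by rewrite -t; apply: (@top_pos_real M); rewrite t.
  have : M l.-1 v (v - (v - top_pos M l v).-1) = S0 by apply: (top_pos_out M0); move: c1; rewrite -/M t; lia.
  have x : v - (v - (v - top_pos M l v).-1) = (v - top_pos M l v).-1 by lia.
  by rewrite /M /mirror -/M x.
by move=> _ _; have := top_pos_ge M0 (mirror_real F0 (top_pos_real c)); rewrite -/M; lia.
Qed.

Notation WR := (weight_right k N lam F (thrice F)).
Notation TG := (thrice_gauge k N lam F).

Notation RA := (rowA k N lam F).
Notation RC := (rowC k N lam F).

Lemma weight_rightE u v i : WR v u i = if u == maxn (RA v u i.-1).1 (maxn (RC v u i).1 (RA v u i).1) then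
   (if thrice F u v i then gauge (RA v u i.-1) (RA v u i)
    else if reduced_right k lam F u v i then 1 else cell F u v i) else 0.
Proof. by []. Qed.

Lemma weight_right_T u v i : thrice F u v i -> WR v u i <= TG v u i.
Proof. by move=> t; rewrite weight_rightE /thrice_gauge t andbT; case: ifP. Qed.

Lemma weight_right_le u v i : ~~ thrice F u v i -> WR v u i <= cell F u v i.
Proof.
move=> t; rewrite weight_rightE; case: ifP => // _; rewrite (negbTE t); case: ifP => // /and4P[m _ /eqP y x].
have [_ _ _ P] := leading_dom F0 Hlam Hlow m.
have p : F u.-1 v i = S0.
  by case: (posnP i) => [->|h]; [apply: (outside_S0 F0); rewrite eqxx orbT|apply: (top_pos_out F0); rewrite P].
by rewrite /cell y p; case: (F u v.-1 i.-1) x; case: (F u v.-1 i).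
Qed.

Lemma weight_right_red u v i : leading k lam u v -> 0 < top_pos F u v -> F u v i = S0 ->
  (F u v.-1 i.-1 != S0) (+) (F u v.-1 i != S0) -> WR v u i <= 1.
Proof.
move=> m y a x; have [_ _ _ P] := leading_dom F0 Hlam Hlow m.
have t : thrice F u v i = false by apply/negP => /and5P[_ _ /eqP b /eqP c _]; rewrite b c in x.
by rewrite weight_rightE t /reduced_right m y a eqxx x; case: ifP.
Qed.

Lemma weight_right_real u v i : F u v i != S0 -> WR v u i = 0.
Proof.
move=> h; rewrite weight_rightE; case: ifP => // /eqP e.
have : u <= (profile F v (cluster_start k lam v u.+1) (cluster_end k N lam v u) i).1.
  apply: (profile_ge F0) => //; [by have := cluster_start_le k lam v u.+1|exact: cluster_end_gt].
have [u0 _ _ _] := F0 h => q.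
suff : u < (RC v u i).1 by lia.
rewrite /rowC /raise; move: q; set P := profile F v _ _ i.
by case: eqP => [z q|_ q]; [rewrite z in q; lia | exact: q].
Qed.

(** Off the levels 4 to k + 4 only (u, v) = (1, 2), the place of the origin, needs an argument: row
    1 is empty and a point of row 2 has raised rank at least 2, so no cell is seen at rank 1. *)
Lemma weight_right_dead u v i : ~~ inner u v -> WR v u i = 0.
Proof.
move=> h; case: (boolP (thrice F u v i)) => [t|t].
  move: (t) => /and5P[p _ _ _ _]; have [u0 i0 iv uv] := F0 p.
  by move: h; rewrite /inner; lia.
apply/eqP; apply/negPn/negP => n.
have c : cell F u v i != 0 by have := weight_right_le t; lia.
have dead : [|| u == 0, v <= 1 | k + 4 < u + v] -> cell F u v i = 0.
  by move=> q; rewrite /cell face_weight_zero //; apply: (outside_S0 F0); lia.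
have uv : [/\ 0 < u, 1 < v & u + v <= k + 4].
  by split; rewrite leqNgt; apply/negP => q; move: c; rewrite dead //; lia.
have v2 : v = 2 /\ u = 1 by move: h; rewrite /inner; lia.
case: v2 => v2 u1; subst.
move: n; rewrite weight_rightE; case: ifP => // /eqP.
have Az j : (RA 2 1 j).1 = 0.
  by rewrite /rowA; case: (profileP F0 2.-1 (cluster_start k lam 2 2) (cluster_end k N lam 2 1) j) => [[]//|[_ _ _ /F0[_ h1 h2 _] _]]; lia.
rewrite !Az max0n maxn0 /rowC; set P := profile F 2 _ _ i.
by rewrite /raise; case: eqP => [->|z] //= [e]; case: z.
Qed.

Lemma right_bound :
  2 * (k + 1) + nsum k.+1 (fun j => jump k lam (j + 4) * ties (j + 4))
  <= box (fun u v => nsum N (fun i => WR v u i.+1)).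
Proof.
have := @right_total k N lam F (thrice F) F0 Hlam Hlow (@thrice_sing F) kN (fun l v => ties (l + v)) ties_split.
rewrite nsum_swap (nsum_swap N N (fun v u => nsum N (fun i => WR v u i.+1))).
have -> : nsum N (fun u => nsum N (fun v => nsum N (fun i => WR v u i.+1))) = box (fun u v => nsum N (fun i => WR v u i.+1)).
  apply: nsum_eq => u _; apply: nsum_eq => v _; case iv : (inner u v); first by rewrite mul1n.
  by apply: nsum_zero => i _; apply: weight_right_dead; rewrite iv.
apply: leq_trans; apply: leq_add.
  rewrite leq_mul2l /=.
  have -> : nsum N (fun u => nsum N (fun v => leading k lam u v : nat)) = box (fun u v => leading k lam u v).
    apply: nsum_eq => u _; apply: nsum_eq => v _; case m : (leading k lam u v); last by rewrite muln0.
    have [_ v2 _ _] := leading_dom F0 Hlam Hlow m; move: m => /andP[m _].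
    have v0 : 0 < v by lia. by rewrite /inner m v0.
  rewrite -diag_box; last by move=> u; case m : (leading k lam u 0) => //; have [] := leading_dom F0 Hlam Hlow m.
  rewrite -[X in X <= _]muln1 addn1 -(nsum_const k.+1 1); apply: nsum_le => j jk.
  have [a b c] := lam_dom F0 Hlam (w := j + 3) ltac:(lia).
  apply: leq_trans (@nsum_ge N (fun u => leading k lam u (j + 4 - u) : nat) (lam (j + 3)) ltac:(lia)).
  rewrite /leading; have -> : lam (j + 3) + (j + 4 - lam (j + 3)) = j + 4 by lia.
  have -> : (j + 4).-1 = j + 3 by lia.
  rewrite eqxx; lia.
have -> : nsum N (split_surplus k N lam (fun l v => ties (l + v))) = box (fun l v => new_separator k lam l v * ties (l + v)).
  rewrite /split_surplus nsum_swap; apply: nsum_eq => l _; apply: nsum_eq => v _.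
  case ns : (new_separator k lam l v); last by rewrite !mul0n muln0.
  have [l0 v2 a e] := new_separator_dom F0 Hlam ns.
  have -> : inner l v by rewrite /inner; lia.
  by rewrite !mul1n.
rewrite -(@diag_box (fun l v => new_separator k lam l v * ties (l + v))); last first.
  by move=> u; case ns : (new_separator k lam u 0) => //; have [] := new_separator_dom F0 Hlam ns.
apply: nsum_le => j jk; case jp : (jump k lam (j + 4)) => //.
have [a b c] := lam_dom F0 Hlam (w := j + 4) ltac:(move: jp => /andP[]; lia).
apply: leq_trans (@nsum_ge N (fun l => new_separator k lam l (j + 4 - l) * ties (l + (j + 4 - l))) (lam (j + 4)) ltac:(lia)).
have -> : lam (j + 4) + (j + 4 - lam (j + 4)) = j + 4 by lia.
rewrite /new_separator; have -> : lam (j + 4) + (j + 4 - lam (j + 4)) = j + 4 by lia.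
by rewrite jp eqxx.
Qed.

(** The single point is a - e_2. The left and right views already use up the 4 of the node, so the
    whole top weight is overrun. If column [u] still had a point in row [v], top and right weight
    would both be reduced to 1. *)
Definition excess_top u v i := if [&& leading k lam u v, top_pos F u v == 0, F u v.-1 i.-1 != S0,
   F u v i == S0, F u.-1 v i == S0 & F u v.-1 i == S0] then weight_top k lam F u v i else 0.
Definition excess_bottom u v i := if [&& leading k lam u v, top_pos F u v == 0, F u v.-1 i != S0,
   F u v i == S0, F u.-1 v i == S0 & F u v.-1 i.-1 == S0] then weight_top k lam M u v (v - i) else 0.

Lemma mirror_cell u v i : 0 < i -> i < v ->
  [/\ M u v (v - i) = F u v i, M u.-1 v (v - i) = F u.-1 v i,
      M u v.-1 (v - i).-1 = F u v.-1 i & M u v.-1 (v - i) = F u v.-1 i.-1].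
Proof.
move=> i0 iv; rewrite /M /mirror.
have -> : v - (v - i) = i by lia.
have -> : v.-1 - (v - i).-1 = i by lia.
by have -> : v.-1 - (v - i) = i.-1 by lia.
Qed.

(** With two or more points in the support the number of views settles it. With one point, the view
    whose facet it belongs to sees nothing, and the four choices of the point give [g1] for a, [g2]
    for a - e_1, [g3] for a - e_2 and [g4] for a - e_3. *)
Lemma pointwise u v i : u < N -> 0 < i ->
  weight_top k lam F u v i + weight_top k lam M u v (v - i) + weight_left k lam F u v i + WR v u i
  <= 4 * node_at u v i + TG v u i + excess_top u v i + excess_bottom u v i.
Proof.
move=> uN i0; case: (leqP v i) => [vi|iv].
  have cz : cell F u v i = 0 by rewrite /cell face_weight_zero //; apply: (outside_S0 F0); lia.
  have w1 : weight_top k lam F u v i = 0 by apply: (weight_top_dead F0); lia.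
  have w2 : weight_top k lam M u v (v - i) = 0 by apply: (weight_top_dead M0); lia.
  have w3 : weight_left k lam F u v i = 0 by rewrite /weight_left cz if_same.
  have tz : thrice F u v i = false by apply/negP => /and5P[/F0[]]; lia.
  by have := weight_right_le (negbT tz); rewrite cz w1 w2 w3; lia.
have [ma mb md mc] := mirror_cell u i0 iv.
set a := F u v i in ma *; set b := F u.-1 v i in mb *.
set c := F u v.-1 i.-1 in mc *; set d := F u v.-1 i in md *.
have cF : cell F u v i = face_weight a b c d by [].
have f1 := weight_top_le F u v i; rewrite cF in f1.
have f1' : d != S0 -> weight_top k lam F u v i = 0.
  by move=> h; rewrite /weight_top; case: ifP => // /and3P[_ _ x]; have := top_pos_ge F0 h; lia.
have f2 : weight_top k lam M u v (v - i) <= face_weight a b d c.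
  by have := weight_top_le M u v (v - i); rewrite /cell ma mb md mc.
have f2' : c != S0 -> weight_top k lam M u v (v - i) = 0.
  move=> h; rewrite /weight_top; case: ifP => // /and3P[_ _ x].
  have h' : M u v.-1 (v - i) != S0 by rewrite mc.
  by have := top_pos_ge M0 h'; rewrite -/M; lia.
have f3 : weight_left k lam F u v i <= face_weight a b c d by rewrite /weight_left cF; case: ifP.
have f3' : b != S0 -> weight_left k lam F u v i = 0.
  move=> h; rewrite /weight_left; case: ifP => // /(leading_dom F0 Hlam Hlow)[_ _ _ z].
  by have := top_pos_gt0 F0 h; lia.
have f4 : (thrice F u v i && (WR v u i <= TG v u i)) || (~~ thrice F u v i && (WR v u i <= face_weight a b c d)).
  by case: (boolP (thrice F u v i)) => [/weight_right_T ->|/weight_right_le ->].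
have f4' : a != S0 -> WR v u i = 0 by apply: weight_right_real.
have ab x y z t : face_weight x y z t <= 4 * isnode x y z t by case: x; case: y; case: z; case: t.
(* Visibility from both ends empties the fibre over (u, v - 1), which a leading pair has
   occupied. *)
have g1 : 0 < weight_top k lam F u v i -> 0 < weight_top k lam M u v (v - i) -> weight_left k lam F u v i = 0.
  rewrite /weight_top; case: ifP => // /and3P[_ _ x] _; case: ifP => // /and3P[_ _ y] _.
  rewrite /weight_left; case: ifP => // /(leading_dom F0 Hlam Hlow)[_ _ z _].
  have := top_pos_ge M0 (mirror_real F0 (top_pos_real z)); rewrite -/M.
  have [_ h _] := top_pos_dom F0 z; lia.
have g2 : 0 < weight_top k lam F u v i -> 0 < weight_top k lam M u v (v - i) -> b != S0 -> a = S0 -> c = S0 -> d = S0 -> thrice F u v i.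
  rewrite /weight_top; case: ifP => // V _; case: ifP => // V' _ h1 h2 h3 h4.
  by rewrite /thrice -/a -/b -/c -/d h1 h2 h3 h4 V V'.
have g3 : c != S0 -> a = S0 -> b = S0 -> d = S0 ->
   weight_top k lam F u v i + weight_left k lam F u v i + WR v u i <= 4 + excess_top u v i.
  move=> h1 h2 h3 h4; have b2 : face_weight a b c d = 2 by rewrite h2 h3 h4; case: (c) h1.
  rewrite b2 in f1 f3 f4.
  have t : thrice F u v i = false by apply/negP => /and5P[x]; rewrite -/b h3 in x.
  rewrite t /= in f4.
  case m : (leading k lam u v); last by rewrite /weight_left m; lia.
  rewrite /excess_top m -/a -/b -/c -/d h1 h2 h3 h4 !eqxx !andbT /=.
  case: (posnP (top_pos F u v)) => [_|p] /=; first by lia.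
  have r1 : weight_top k lam F u v i <= 1.
    rewrite /weight_top; case: ifP => // _.
    by rewrite /reduced_top m -/a -/b -/c -/d h1 h2 h3 h4 p.
  have : WR v u i <= 1 by apply: weight_right_red => //; rewrite -/c -/d h1 h4.
  lia.
have g4 : d != S0 -> a = S0 -> b = S0 -> c = S0 ->
   weight_top k lam M u v (v - i) + weight_left k lam F u v i + WR v u i <= 4 + excess_bottom u v i.
  move=> h1 h2 h3 h4; have b2 : face_weight a b c d = 2 by rewrite h2 h3 h4; case: (d) h1.
  have b2' : face_weight a b d c = 2 by rewrite h2 h3 h4; case: (d) h1.
  rewrite b2 in f1 f3 f4; rewrite b2' in f2.
  have t : thrice F u v i = false by apply/negP => /and5P[x]; rewrite -/b h3 in x.
  rewrite t /= in f4.
  case m : (leading k lam u v); last by rewrite /weight_left m; lia.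
  rewrite /excess_bottom m -/a -/b -/c -/d h1 h2 h3 h4 !eqxx !andbT /=.
  case: (posnP (top_pos F u v)) => [_|p] /=; first by lia.
  have pM : 0 < top_pos M u v by have := mirror_mx0 F0 u v; rewrite -/M; lia.
  have r1 : weight_top k lam M u v (v - i) <= 1.
    rewrite /weight_top; case: ifP => // _.
    by rewrite /reduced_top m ma mb mc md h1 h2 h3 h4 pM.
  have : WR v u i <= 1 by apply: weight_right_red => //; rewrite -/c -/d h1 h4.
  lia.
rewrite /node_at -/a -/b -/c -/d.
move: f1 f1' f2 f2' f3 f3' f4 f4' g1 g2 g3 g4.
move: (weight_top k lam F u v i) (weight_top k lam M u v (v - i)) (weight_left k lam F u v i) (WR v u i) => w1 w2 w3 w4.
move: (excess_top u v i) (excess_bottom u v i) (TG v u i) => t1 t2 t3.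
case: (thrice F u v i) => /=; clearbody a b c d; clear;
 case: a; case: b; case: c; case: d; rewrite /face_weight /isnode /support_size /=;
 move=> f1 f1' f2 f2' f3 f3' f4 f4' g1 g2 g3 g4;
 try (have := f1' isT); try (have := f2' isT); try (have := f3' isT); try (have := f4' isT);
 try (have := g3 isT erefl erefl erefl); try (have := g4 isT erefl erefl erefl);
 clear f1' f2' f3' f4' g3 g4; try lia;
 case: (posnP w1) => p1; case: (posnP w2) => p2; try (have := g1 p1 p2); try (have := g2 p1 p2 isT erefl erefl erefl); try done; lia.
Qed.

Definition excess_bound (G : nat -> nat -> nat -> sgn) w :=
  jump k lam w * (1 + tied lam G w) + (w == k + 4) * 2.

(** As column [u] led the previous level and is empty now, either [lam] jumps at level u + v or this
    is the level k + 4 beyond the support. At an untied jump the weight is the reduced 1, otherwise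
    it is 2. *)
Lemma weight_top_term (G : nat -> nat -> nat -> sgn) u v i :
  (forall u v i, G u v i != S0 -> [/\ 0 < u, 0 < i, i < v & u + v <= k + 3]) ->
  (forall w, 3 <= w <= k + 3 -> exists i, G (lam w) (w - lam w) i != S0) ->
  leading k lam u v -> top_pos G u v = 0 -> G u v.-1 i.-1 != S0 ->
  G u v i = S0 -> G u.-1 v i = S0 -> G u v.-1 i = S0 ->
  weight_top k lam G u v i <= (i == (top_pos G u v.-1).+1) * excess_bound G (u + v).
Proof.
move=> G0 Glam m Y c a b d; rewrite /weight_top; case: ifP => // /and3P[_ _ lt].
have -> : i == (top_pos G u v.-1).+1 by have := top_pos_ge G0 c; lia.
rewrite mul1n /reduced_top m a b c d Y /= /excess_bound.
have cE : cell G u v i = 2 by rewrite /cell a b d; case: (G u v.-1 i.-1) c.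
rewrite cE; case jp : (jump k lam (u + v)) => /=.
  by case: (tied lam G (u + v)) => /=; lia.
have -> : u + v == k + 4 by move: m jp; rewrite /leading /jump => /andP[h /eqP e] jp;
  apply: contraFT jp => ne; apply/andP; split; [lia|rewrite e; apply/eqP => l;
  have [|j] := Glam (u + v); [lia|rewrite l addKn => /(top_pos_gt0 G0); rewrite Y]].
by [].
Qed.

Lemma excess_top_le u v : nsum N (excess_top u v \o succn) <= leading k lam u v * excess_bound F (u + v).
Proof.
apply: leq_trans (_ : nsum N (fun i => (i == top_pos F u v.-1) * (leading k lam u v * excess_bound F (u + v))) <= _).
  apply: nsum_le => i _; rewrite /= /excess_top; case: ifP => // /and5P[m /eqP y c /eqP a /andP[/eqP b /eqP d]].
  by rewrite m mul1n; apply: (weight_top_term F0 Hlam).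
by rewrite nsum_delta; case: (_ < _); rewrite ?mul1n.
Qed.

Lemma excess_bottom_le u v : nsum N (excess_bottom u v \o succn) <= leading k lam u v * excess_bound M (u + v).
Proof.
apply: leq_trans (_ : nsum N (fun i => (i == v - (top_pos M u v.-1).+2) * (leading k lam u v * excess_bound M (u + v))) <= _).
  apply: nsum_le => i _; rewrite /= /excess_bottom; case: ifP => // /and5P[m /eqP y c a /andP[b d]].
  case: (leqP v i.+1) => [h|iv]; first by rewrite (weight_top_dead M0) //; lia.
  have [ma mb md mc] := mirror_cell u (isT : 0 < i.+1) iv.
  have yM : top_pos M u v = 0 by apply/eqP; rewrite (mirror_mx0 F0) y.
  have := @weight_top_term M u v (v - i.+1) M0 Mlam m yM.
  rewrite ma mb mc md (eqP a) (eqP b) (eqP d) => /(_ c erefl erefl erefl) le.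
  apply: leq_trans le _; rewrite m mul1n leq_mul2r; apply/orP; right.
  by case: (v - i.+1 =P _) => // e; case: eqP => //; lia.
by rewrite nsum_delta; case: (_ < _); rewrite ?mul1n.
Qed.

Lemma leading_box G : box (fun u v => leading k lam u v * excess_bound G (u + v)) <=
  nsum k.+1 (fun j => jump k lam (j + 4)) + nsum k.+1 (fun j => jump k lam (j + 4) * tied lam G (j + 4)) + 2.
Proof.
rewrite -(@diag_box (fun u v => leading k lam u v * excess_bound G (u + v))); last first.
  by move=> u; case m : (leading k lam u 0) => //; have [] := leading_dom F0 Hlam Hlow m.
apply: leq_trans (_ : nsum k.+1 (fun j => excess_bound G (j + 4)) <= _).
  apply: nsum_le => j jk.
  apply: leq_trans (_ : nsum N (fun u => (u == lam (j + 3)) * excess_bound G (j + 4)) <= _).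
    apply: nsum_le => u _; case m : (leading k lam u (j + 4 - u)) => //.
    have [u0 v2 _ _] := leading_dom F0 Hlam Hlow m.
    move: m => /andP[_ /eqP].
    have -> : u + (j + 4 - u) = j + 4 by lia.
    have -> : (j + 4).-1 = j + 3 by lia.
    by move=> ->; rewrite eqxx.
  by rewrite nsum_delta; case: (_ < _); rewrite ?mul1n.
have e : nsum k.+1 (fun j => (j == k) * 2) = 2 by rewrite nsum_delta ltnSn.
rewrite -[X in _ <= _ + X]e -!nsumD; apply: nsum_le => j _; rewrite /excess_bound eqn_add2r.
by case: (jump k lam (j + 4)); rewrite /=; lia.
Qed.

Lemma events_box (G : nat -> nat -> nat -> sgn) :
  (forall u v i, G u v i != S0 -> [/\ 0 < u, 0 < i, i < v & u + v <= k + 3]) ->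
  nsum N (fun v => (3 <= v) * nsum N (fun t => events G t v))
  <= nsum k.+1 (fun j => nsum N (fun t => events G t (j + 4 - t))).
Proof.
move=> G0; apply: leq_trans (_ : box (fun t v => (3 <= v) * events G t v) <= _).
  rewrite (@nsum_eq N _ (fun v => nsum N (fun t => (3 <= v) * events G t v))); last first.
    by move=> v _; rewrite nsum_mulr.
  rewrite nsum_swap; apply: nsum_le => t _; apply: nsum_le => v _.
  case: (leqP 3 v) => v3; last by rewrite mul0n.
  case: (posnP (top_pos G t v)) => [z|p]; first by rewrite /events /event_cell /event_up z !muln0.
  have [t0 _ tv] := top_pos_dom G0 p.
  have -> : inner t v by rewrite /inner; lia.
  by rewrite !mul1n.
rewrite -(@diag_box (fun t v => (3 <= v) * events G t v)) //.
by apply: nsum_le => j _; apply: nsum_le => t _; case: (3 <= _); rewrite ?mul1n.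
Qed.

Lemma thrice_gauge_box : box (fun u v => nsum N (fun i => TG v u i.+1)) <=
  nsum k.+1 (fun j => nsum N (fun t => events F t (j + 4 - t))) + nsum k.+1 (fun j => nsum N (fun t => events M t (j + 4 - t))).
Proof.
apply: leq_trans (leq_add (events_box F0) (events_box M0)); rewrite -nsumD.
rewrite /box nsum_swap; apply: nsum_le => v _.
rewrite -mulnDr; case: (leqP 3 v) => v3.
  rewrite mul1n; apply: leq_trans (thrice_gauge_row F0 Hlam Hlow kN v).
  by apply: nsum_le => u _; case: (inner u v); rewrite ?mul1n.
rewrite mul0n leqn0; apply/eqP; apply: nsum_zero => u _; rewrite nsum_zero ?muln0 // => i _.
have Az j : (RA v u j).1 = 0.
  by rewrite /rowA; case: (profileP F0 v.-1 (cluster_start k lam v u.+1) (cluster_end k N lam v u) j) => [[]//|[_ _ _ /F0[_ h1 h2 _] _]]; lia.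
by rewrite /thrice_gauge /gauge !Az eqxx; case: ifP.
Qed.

Lemma node_count : 2 * k + 3 <= box (fun u v => nsum N (fun i => node_at u v i.+1)).
Proof.
have P : box (fun u v => nsum N (fun i => weight_top k lam F u v i.+1))
     + box (fun u v => nsum N (fun i => weight_top k lam M u v (v - i.+1)))
     + box (fun u v => nsum N (fun i => weight_left k lam F u v i.+1)) + box (fun u v => nsum N (fun i => WR v u i.+1))
  <= 4 * box (fun u v => nsum N (fun i => node_at u v i.+1)) + box (fun u v => nsum N (fun i => TG v u i.+1))
     + box (fun u v => leading k lam u v * excess_bound F (u + v)) + box (fun u v => leading k lam u v * excess_bound M (u + v)).
  rewrite -box_mul -!boxD.
  apply: box_le => u v uN vN iv.
  apply: leq_trans (_ : _ <= 4 * nsum N (fun i => node_at u v i.+1) + nsum N (fun i => TG v u i.+1)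
     + nsum N (excess_top u v \o succn) + nsum N (excess_bottom u v \o succn)) _.
    by rewrite -nsum_mulr -!nsumD; apply: nsum_le => i iN; apply: pointwise.
  by rewrite -!addnA !leq_add2l; apply: leq_add; [apply: excess_top_le|apply: excess_bottom_le].
move: P.
have := plus_bound; have := minus_bound; have := left_bound; have := right_bound.
have := thrice_gauge_box; have := leading_box F; have := leading_box M.
have -> : nsum k.+1 (fun j => jump k lam (j + 4) * ties (j + 4)) =
  nsum k.+1 (fun j => jump k lam (j + 4) * tied lam F (j + 4)) + nsum k.+1 (fun j => jump k lam (j + 4) * tied lam M (j + 4)).
  by rewrite -nsumD; apply: nsum_eq => j _; rewrite mulnDr.
(* The views give 3 * 2(k + 2) + 2(k + 1) = 8k + 14. Events, jumps and ties cancel, the last level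
   takes 2 + 2, and 8k + 10 <= 4n forces n >= 2k + 3. *)
lia.
Qed.
End Total.

(** * From the diagram to its shifted coordinates *)

Section Lambda.
Variables (k : nat) (F : nat -> nat -> nat -> sgn).
Hypothesis F0 : forall u v i, F u v i != S0 -> [/\ 0 < u, 0 < i, i < v & u + v <= k + 3].
Hypothesis noleft : forall u v i, F u v i != S0 -> 3 < u + v ->
  (exists j, F u v.-1 j != S0) \/ (exists v' j, v <= v' /\ F u.-1 v' j != S0).

(** Each use of [noleft] lowers [v] in the same column or moves to a smaller column with arbitrary
    [v], so the descent is lexicographic and can stop only at level 3. *)
Lemma origin_real u v i : F u v i != S0 -> F 1 2 1 != S0.
Proof.
elim: u v i => [|u IHu] v i Fi; first by have [] := F0 Fi.
elim: v i Fi => [|v IHv] i Fi; first by have [_ _] := F0 Fi; rewrite ltn0.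
have [_ i0 iv _] := F0 Fi.
case: (leqP (u.+1 + v.+1) 3) => h.
  by move: Fi; have [-> -> ->] : [/\ u = 0, v = 1 & i = 1] by split; lia.
case: (noleft Fi h) => [[j /IHv //]|[v' [j [_ /IHu //]]]].
Qed.

Definition reach w u := has (fun v => (w <= u + v) && has (fun i => F u v i != S0) (iota 0 v)) (iota 0 (k + 4)).
Definition leftmost w := find (reach w) (iota 0 (k + 4)).

Lemma reachP w u : reflect (exists v i, w <= u + v /\ F u v i != S0) (reach w u).
Proof.
apply: (iffP hasP) => [[v _ /andP[wv /hasP[i _ Fi]]]|[v [i [wv Fi]]]].
  by exists v, i.
have [a b c d] := F0 Fi; exists v; first by rewrite mem_iota; lia.
by rewrite wv; apply/hasP; exists i => //; rewrite mem_iota; lia.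
Qed.

Hypothesis topreal : exists u v i, F u v i != S0 /\ u + v = k + 3.

Lemma leftmost_lt w : w <= k + 3 -> leftmost w < k + 4 /\ reach w (leftmost w).
Proof.
move=> wk; have [u [v [i [Fi e]]]] := topreal.
have h : has (reach w) (iota 0 (k + 4)).
  have [a b c d] := F0 Fi; apply/hasP; exists u; first by rewrite mem_iota; lia.
  by apply/reachP; exists v, i; split=> //; lia.
have lt : leftmost w < k + 4 by move: h; rewrite has_find size_iota.
by split=> //; have := nth_find 0 h; rewrite nth_iota.
Qed.

Lemma leftmost_low w u v i : 3 <= w <= k + 3 -> u < leftmost w -> w <= u + v -> F u v i = S0.
Proof.
move=> hw ul wv; apply/eqP; apply/negPn/negP => Fi.
have [lt _] := @leftmost_lt w ltac:(lia).
have := @before_find _ 0 (reach w) (iota 0 (k + 4)) u ul.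
rewrite nth_iota; last by lia.
by rewrite add0n => /negP; apply; apply/reachP; exists v, i.
Qed.

(** Descend in the leftmost column from a point on level [w] or above: a step to the left would give
    a column further left that still reaches level [w], so [noleft] leads down to level [w]
    itself. *)
Lemma leftmost_real w : 3 <= w <= k + 3 -> exists i, F (leftmost w) (w - leftmost w) i != S0.
Proof.
move=> hw; have [lt /reachP[v [i [wv Fi]]]] := @leftmost_lt w ltac:(lia).
elim: v i wv Fi => [|v IH] i wv Fi; first by have [_ _] := F0 Fi; rewrite ltn0.
case: (ltngtP w (leftmost w + v.+1)) wv => // [h _|h _]; last first.
  by exists i; have -> : w - leftmost w = v.+1 by lia.
case: (noleft Fi); first by lia.
  by move=> [j Fj]; apply: (IH j) => //; lia.
move=> [v' [j [vv Fj]]]; have [l0 _ _ _] := F0 Fi; have [l0' _ _ _] := F0 Fj.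
by move: Fj; rewrite (@leftmost_low w) //; lia.
Qed.
End Lambda.

Lemma foldr_extremum (f : int -> int -> int) x0 s : (forall x y, f x y \in [:: x; y]) ->
  foldr f x0 s \in x0 :: s.
Proof.
move=> fE; elim: s => [|x s IH] /=; first by rewrite mem_head.
have := fE x (foldr f x0 s); rewrite !inE => /orP[] /eqP ->; first by rewrite eqxx orbT.
by move: IH; rewrite inE => /orP[-> //|->]; rewrite !orbT.
Qed.

Lemma maxl_in s : s != [::] -> maxl s \in s.
Proof.
case: s => // x s _; have := @foldr_extremum Num.max x (x :: s).
rewrite /maxl /= !inE; case/(_ _)/orP => [a b||->]; rewrite ?orbT //.
  by rewrite !inE maxEle; case: ifP; rewrite eqxx ?orbT.
by move=> ->.
Qed.

Lemma minl_in s : s != [::] -> minl s \in s.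
Proof.
case: s => // x s _; have := @foldr_extremum Num.min x (x :: s).
rewrite /minl /= !inE; case/(_ _)/orP => [a b||->]; rewrite ?orbT //.
  by rewrite !inE minEle; case: ifP; rewrite eqxx ?orbT.
by move=> ->.
Qed.

Lemma maxl_ge s x : x \in s -> (x <= maxl s)%R.
Proof.
rewrite /maxl; elim: s (head _ _) => //= y s IH x0; rewrite inE le_max => /orP[/eqP ->|/IH ->].
  by rewrite lexx.
by rewrite orbT.
Qed.

Lemma minl_le s x : x \in s -> (minl s <= x)%R.
Proof.
rewrite /minl; elim: s (head _ _) => //= y s IH x0; rewrite inE ge_min => /orP[/eqP ->|/IH ->].
  by rewrite lexx.
by rewrite orbT.
Qed.

Lemma minl_zero s : 0%R \in s -> (forall x, x \in s -> (0 <= x)%R) -> minl s = 0%R.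
Proof.
move=> s0 H; apply/eqP; rewrite eq_le minl_le //=.
by apply: H; apply: minl_in; apply/eqP => e; rewrite e in s0.
Qed.

Lemma is_nodeE D a : is_node D a = isnode (D a) (D (pt (c1 a - 1) (c2 a) (c3 a)))
  (D (pt (c1 a) (c2 a - 1) (c3 a))) (D (pt (c1 a) (c2 a) (c3 a - 1))).
Proof.
by rewrite /is_node /E /=; case: (D _); case: (D _); case: (D _); case: (D _).
Qed.

Lemma box_card N (P : nat -> nat -> nat -> bool) :
  nsum N (fun u => nsum N (fun v => nsum N (fun i => P u v i)))
  = #|[set p : 'I_N * 'I_N * 'I_N | P p.1.1 p.1.2 p.2]|.
Proof.
rewrite -sum1_card big_mkcond /= /nsum pair_big /= pair_big /=.
by apply: eq_bigr => -[[u v] i] _; rewrite inE /=; case: (P u v i).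
Qed.

Section Reduction.
Variables (D : Z3 -> sgn) (K : seq Z3).
Hypothesis K0 : K != [::].
Hypothesis Kpos : forall m, m \in K -> [/\ (0 <= c1 m)%R, (0 <= c2 m)%R & (0 <= c3 m)%R].
Hypothesis DK : support_is D K.
Hypothesis noK : no_overhang K.

Let k := absz (maxl (map abs1 K)).
Let N := k + 10.

(* Coordinates are shifted by one, so that index 0, and with it every
   truncated subtraction, lands outside the support. *)
Definition shifted u v i : sgn := D (pt (u%:Z - 1)%R (i%:Z - 1)%R ((v - i)%:Z - 1)%R).

Let F := shifted.

Lemma abs_le m : m \in K -> (abs1 m <= k%:Z)%R.
Proof.
move=> mK; have h : (abs1 m <= maxl (map abs1 K))%R by apply: maxl_ge; apply: map_f.
have p : (0 <= abs1 m)%R by have [] := Kpos mK; rewrite /abs1; lia.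
by rewrite /k; lia.
Qed.

Lemma shifted_in u v i : F u v i != S0 ->
  pt (u%:Z - 1)%R (i%:Z - 1)%R ((v - i)%:Z - 1)%R \in K.
Proof. by rewrite /F /shifted DK. Qed.

Lemma shifted_dom u v i : F u v i != S0 -> [/\ 0 < u, 0 < i, i < v & u + v <= k + 3].
Proof.
move=> /shifted_in h; have := abs_le h; have [] := Kpos h; rewrite /abs1 /c1 /c2 /c3 /=.
by split; lia.
Qed.

Lemma shifted_real x y z : pt x y z \in K ->
  F (absz (x + 1)%R) (absz (y + z + 2)%R) (absz (y + 1)%R) != S0.
Proof.
move=> h; have [] := Kpos h; rewrite /c1 /c2 /c3 /= => x0 y0 z0.
rewrite /F /shifted DK.
have -> : ((absz (x + 1)%R)%:Z - 1 = x)%R by lia.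
have -> : ((absz (y + 1)%R)%:Z - 1 = y)%R by lia.
by have -> : (((absz (y + z + 2)%R) - (absz (y + 1)%R))%N%:Z - 1 = z)%R by lia.
Qed.

(** The condition [3 < u + v] says that the image under [pi1] is not (0, 0), the point exempt from
    being an overhang. *)
Lemma shifted_noleft u v i : F u v i != S0 -> 3 < u + v ->
  (exists j, F u v.-1 j != S0) \/ (exists v' j, v <= v' /\ F u.-1 v' j != S0).
Proof.
move=> Fi uv; have [u0 i0 iv _] := shifted_dom Fi; have mK := shifted_in Fi.
set m := pt _ _ _ in mK.
have pm : pi1 m = (u%:Z - 1, v%:Z - 2)%R.
  by rewrite /pi1 /m /c1 /c2 /c3 /=; congr (_, _); lia.
case: (boolP ((u%:Z - 1, v%:Z - 2 - 1)%R \in map pi1 K)) => [/mapP[[[x y] z] xK []]|n1].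
  rewrite /c1 /c2 /c3 /= => e1 e2; left; have := shifted_real xK.
  have [] := Kpos xK; rewrite /c1 /c2 /c3 /= => x0 y0 z0.
  have -> : (absz (x + 1)%R) = u by lia.
  have -> : (absz (y + z + 2)%R) = v.-1 by lia.
  by exists (absz (y + 1)%R).
case: (boolP (has (fun q : Z2 => (q.1 == u%:Z - 1 - 1) && (v%:Z - 2 <= q.2))%R (map pi1 K))) => [/hasP[q]|/hasPn n2].
  move=> /mapP[[[x y] z] xK ->]; rewrite /pi1 /c1 /c2 /c3 /= => /andP[/eqP e1 e2].
  right; have := shifted_real xK.
  have [] := Kpos xK; rewrite /c1 /c2 /c3 /= => x0 y0 z0.
  have -> : (absz (x + 1)%R) = u.-1 by lia.
  by exists (absz (y + z + 2)%R), (absz (y + 1)%R); split=> //; lia.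
exfalso; apply: (noK (m := m)); split=> //; constructor 1; left.
rewrite pm; split=> //.
- by rewrite -pm; apply: map_f.
- by rewrite xpair_eqE; apply/negP => /andP[/eqP a /eqP b]; lia.
- move=> y vy; apply/negP => h; have := n2 _ h; rewrite /= eqxx vy //.
Qed.

Lemma top_real : exists u v i, F u v i != S0 /\ u + v = k + 3.
Proof.
have mK : map abs1 K != [::] by case: (K) K0.
have /mapP[[[x y] z] xK e] := maxl_in mK.
have [] := Kpos xK; rewrite /c1 /c2 /c3 /= => x0 y0 z0.
exists (absz (x + 1)%R), (absz (y + z + 2)%R), (absz (y + 1)%R); split; first exact: shifted_real.
by rewrite /k e /abs1 /c1 /c2 /c3 /=; lia.
Qed.

Lemma shifted_origin : F 1 2 1 != S0.
Proof.
have [u [v [i [Fi _]]]] := top_real.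
exact: (origin_real shifted_dom shifted_noleft Fi).
Qed.

Lemma origin_in : pt 0%R 0%R 0%R \in K.
Proof. by have := shifted_in shifted_origin. Qed.

(** Since the origin lies in the support, all coordinate minima are 0 and the size is k + 1. *)
Lemma size_KE : (2 * size_K K + 2 = (2 * k + 4)%:Z)%R.
Proof.
have z (c : Z3 -> int) : c (pt 0%R 0%R 0%R) = 0%R -> (forall m, m \in K -> (0 <= c m)%R) ->
    minl (map c K) = 0%R.
  move=> c0 H; apply: minl_zero; first by rewrite -c0; apply: map_f; apply: origin_in.
  by move=> x /mapP[m mK ->]; apply: H.
rewrite /size_K !z //; try by move=> m /Kpos[].
have : (0 <= maxl (map abs1 K))%R by have := maxl_ge (map_f abs1 origin_in).
by rewrite /k; lia.
Qed.

Definition unshift (p : nat * nat * nat) : Z3 :=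
  pt (p.1.1%:Z - 1)%R (p.2%:Z - 1)%R ((p.1.2 - p.2)%:Z - 1)%R.

Lemma node_at_dom u v i : node_at F u v i -> [/\ 0 < u, 0 < i & i < v].
Proof.
move=> n; suff h : ~~ ([|| u == 0, i == 0 | v <= i]) by split; lia.
apply: contraTN n => h; rewrite /node_at.
have z a b c : [|| a == 0, c == 0 | b <= c] -> F a b c = S0.
  by move=> q; apply/eqP; apply/negPn/negP => /shifted_dom[h1 h2 h3 _]; lia.
by rewrite !z //; lia.
Qed.

Lemma node_at_node u v i : 0 < u -> 0 < i -> i < v -> node_at F u v i = is_node D (unshift (u, v, i)).
Proof.
move=> u0 i0 iv; rewrite is_nodeE /node_at /unshift /F /shifted /c1 /c2 /c3 /=.
have -> : (u.-1%:Z - 1 = u%:Z - 1 - 1)%R by lia.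
have -> : (i.-1%:Z - 1 = i%:Z - 1 - 1)%R by lia.
have -> : v.-1 - i.-1 = v - i by lia.
by have -> : ((v.-1 - i)%N%:Z - 1 = (v - i)%N%:Z - 1 - 1)%R by lia.
Qed.

Lemma node_dom a : is_node D a ->
  [/\ (0 <= c1 a <= k%:Z + 1)%R, (0 <= c2 a <= k%:Z + 1)%R & (0 <= c3 a <= k%:Z + 1)%R].
Proof.
have b m : D m != S0 -> [/\ (0 <= c1 m <= k%:Z)%R, (0 <= c2 m <= k%:Z)%R & (0 <= c3 m <= k%:Z)%R].
  by rewrite DK => mK; have := abs_le mK; have [] := Kpos mK; rewrite /abs1; split; lia.
rewrite is_nodeE => n.
have : [|| D a != S0, D (pt (c1 a - 1) (c2 a) (c3 a))%R != S0,
   D (pt (c1 a) (c2 a - 1) (c3 a))%R != S0 | D (pt (c1 a) (c2 a) (c3 a - 1))%R != S0].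
  by move: n; case: (D _); case: (D _); case: (D _); case: (D _).
by case/or4P => /b[]; rewrite /c1 /c2 /c3 /=; split; lia.
Qed.

Lemma origin_node : is_node D (pt 0%R 0%R 0%R).
Proof.
have out m : m \notin K -> D m = S0 by move=> h; apply/eqP; apply: contraNT h; rewrite DK.
have neg x y z : [|| x < 0, y < 0 | z < 0]%R -> D (pt x y z) = S0.
  by move=> h; apply: out; apply/negP => /Kpos[]; rewrite /c1 /c2 /c3 /=; move: h; lia.
rewrite is_nodeE (neg (c1 (pt 0 0 0) - 1)%R) ?(neg _ (c2 (pt 0 0 0) - 1)%R)
  ?(neg _ _ (c3 (pt 0 0 0) - 1)%R) ?orbT //.
by have := origin_in; rewrite -DK; case: (D _).
Qed.

Definition cells : {set 'I_N * 'I_N * 'I_N} :=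
  [set p : 'I_N * 'I_N * 'I_N | inner k p.1.1 p.1.2 && node_at F p.1.1 p.1.2 p.2.+1].

Lemma cells_card : 2 * k + 3 <= #|cells|.
Proof.
have := @node_count k N (leftmost k F) F shifted_dom (leftmost_real shifted_dom shifted_noleft top_real)
  (leftmost_low shifted_dom top_real) (leqnn _).
rewrite /cells -(box_card N (fun u v i => inner k u v && node_at F u v i.+1)) /box.
move=> le; apply: leq_trans le _; apply: nsum_le => u _; apply: nsum_le => v _.
by rewrite -nsum_mulr; apply: nsum_le => i _; case: (inner k u v); rewrite ?mul1n.
Qed.

(** All nodes have coordinates between 0 and k + 1, so they can be listed by filtering a finite box;
    the counted cells together with the origin embed into this list. *)
Lemma node_list : exists s : seq Z3,
  [/\ uniq s, (forall a, is_node D a <-> a \in s) & (2 * size_K K + 2 <= (size s)%:Z)%R].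
Proof.
pose rng := [seq Posz n | n <- iota 0 (k + 2)].
have ur : uniq rng by rewrite map_inj_uniq ?iota_uniq // => x y [].
have inr (x : int) : (0 <= x <= k%:Z + 1)%R -> x \in rng.
  move=> h; apply/mapP; exists (absz x); last by lia.
  by rewrite mem_iota; lia.
pose all3 : seq Z3 := [seq (xy, z) | xy <- [seq (x, y) | x <- rng, y <- rng], z <- rng].
exists [seq a <- all3 | is_node D a].
have u3 : uniq all3.
  by apply: allpairs_uniq => //; [apply: allpairs_uniq => // -[? ?] [? ?] | move=> -[? ?] [? ?]].
have mem a : is_node D a <-> a \in [seq a <- all3 | is_node D a].
  rewrite mem_filter; split=> [n|/andP[] //]; rewrite n /=.
  have [h1 h2 h3] := node_dom n; case: a {n} h1 h2 h3 => [[x y] z]; rewrite /c1 /c2 /c3 /= => h1 h2 h3.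
  by apply: allpairs_f; [apply: allpairs_f|]; apply: inr.
split=> //; first by rewrite filter_uniq.
rewrite size_KE; have cc := cells_card.
pose f (p : 'I_N * 'I_N * 'I_N) := unshift (p.1.1 : nat, p.1.2 : nat, p.2.+1).
have cellP p : p \in cells -> [/\ is_node D (f p), 0 < p.1.1, p.2.+1 < p.1.2 & 4 <= p.1.1 + p.1.2].
  rewrite inE => /andP[/andP[_ /andP[a _]] n]; have [b c d] := node_at_dom n.
  by split=> //; rewrite /f -node_at_node.
(* The origin has u + v = 3, while [cells] starts at level 4. *)
have ut : uniq (pt 0%R 0%R 0%R :: map f (enum cells)).
  rewrite /= map_inj_in_uniq ?enum_uniq ?andbT.
    apply/negP => /mapP[p]; rewrite mem_enum => /cellP[_ a b c]; rewrite /f /unshift /=.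
    move=> e; have := congr1 c1 e; have := congr1 c2 e; have := congr1 c3 e.
    rewrite /c1 /c2 /c3 /=; move: a b c.
    by move: (p.1.1 : nat) (p.1.2 : nat) (p.2 : nat) => x y z {e}; clear; lia.
  move=> [[u v] i] [[u' v'] i']; rewrite !mem_enum => /cellP[_ /= a b c] /cellP[_ /= a' b' c'].
  rewrite /f /unshift /= => e.
  have e1 := congr1 c1 e; have e2 := congr1 c2 e; have e3 := congr1 c3 e.
  rewrite /c1 /c2 /c3 /= in e1 e2 e3.
  by congr (_, _, _); apply: val_inj => /=; lia.
have sub : {subset pt 0%R 0%R 0%R :: map f (enum cells) <= [seq a <- all3 | is_node D a]}.
  move=> a; rewrite inE => /orP[/eqP ->|/mapP[p]]; first by apply/mem; apply: origin_node.
  by rewrite mem_enum => /cellP[n _ _ _] ->; apply/mem.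
have := uniq_leq_size ut sub; rewrite /= size_map -cardE; move: cc.
by move: #|cells| (size _) => x y; rewrite lez_nat; lia.
Qed.
End Reduction.

Local Open Scope ring_scope.

Theorem mainTheorem11 (D : Z3 -> sgn) (K : seq Z3) :
  K != [::] ->
  (forall m, m \in K -> [/\ 0 <= c1 m, 0 <= c2 m & 0 <= c3 m]) ->
  support_is D K ->
  no_overhang K ->
  exists s : seq Z3,
    [/\ uniq s, (forall a, is_node D a <-> a \in s)
      & 2 * size_K K + 2 <= (size s)%:Z].
Proof. exact: node_list. Qed.
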